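(* Let $A$ be a commutative unital ring and $(a,b)\in A^2$ a primitive point. Let $A[x,y]:=A[X,Y]/X(aY-bX)A[X,Y]$, where $x$ (resp. $y$) is the image of $X$ (resp. $Y$), endowed with the grading induced by that of $A[X,Y]$, and let $S(a,b):=\operatorname{Proj}A[x,y]$. The following properties are equivalent. (i) The $\mathcal{O}_{S(a,b)}(S(a,b))$-module $\mathcal{O}_{S(a,b)}(1)(S(a,b))$ is a torsion element in the Picard group of the ring $\mathcal{O}_{S(a,b)}(S(a,b))$. (ii) There exists $P(X,Y)\in A[X,Y]$ homogeneous of degree $d\ge 1$ with $P(0,1)\in A^\times$ and $P(a,b)\in A^\times$. (iii) The point $(a,b)\in A^2$ is a good point.
   Context: All rings are commutative and unital; $A^\times$ denotes the unit group of $A$. A point $(a,b)\in A^2$ is primitive if $aA+bA=A$. A primitive point $(a,b)\in A^2$ is a good point if there are an integer $N\ge 1$ and $\lambda\in A$ with $b^N+\lambda a\in A^\times$. $A[X,Y]$ has its standard grading, and $\mathcal{O}_{S(a,b)}(1)$ is the standard twisting sheaf on $\operatorname{Proj}A[x,y]$. *)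

(* Defs.v *)
From HB Require Import structures.
From mathcomp Require Import all_boot all_order all_algebra.
From mathcomp Require Import boolp classical_sets functions fsbigop.
From mathcomp Require Import topology_structure zify ring.

Set Implicit Arguments.
Unset Strict Implicit.
Unset Printing Implicit Defensive.

Import GRing.Theory.
Local Open Scope ring_scope.
Local Open Scope quotient_scope.

(* Every ring is a comPzRingType, so that the zero ring is allowed.  MathComp's *)
(* polynomial rings {poly _}, {mpoly _[_]}, its units and its quotients by      *)
(* ideals all require 1 != 0; this is why they are not used here.               *)

Definition is_unit (R : comPzRingType) (x : R) : Prop := exists y, x * y = 1.

Section Picard.
Variable R : comPzRingType.

Definition bilinear_map (M N P : lmodType R) (f : M -> N -> P) : Prop :=
  (forall m, linear (f m)) /\ (forall n, linear (f^~ n)).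

Definition is_tensor_product (M N T : lmodType R) : Prop :=
  exists t : M -> N -> T, bilinear_map t /\
    forall (P : lmodType R) (f : M -> N -> P), bilinear_map f ->
      exists g : {linear T -> P}, (forall m n, g (t m n) = f m n) /\
        forall g' : {linear T -> P}, (forall m n, g' (t m n) = f m n) -> g' =1 g.

Definition module_iso (M N : lmodType R) : Prop :=
  exists f : {linear M -> N}, bijective f.

Fixpoint is_tensor_power (M : lmodType R) (n : nat) (T : lmodType R) : Prop :=
  if n is n'.+1 then
    exists T' : lmodType R, is_tensor_power M n' T' /\ is_tensor_product M T' T
  else module_iso T R^o.

Definition invertible_module (M : lmodType R) : Prop :=
  exists N : lmodType R, is_tensor_product M N R^o.

(* The Picard group consists of the isomorphism classes of invertible modules   *)
(* under the tensor product; its neutral element is the class of R.             *)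
Definition torsion_in_Pic (M : lmodType R) : Prop :=
  invertible_module M /\ exists2 n, (0 < n)%N & is_tensor_power M n R^o.

End Picard.

Section PrincipalQuotient.
Variables (R : comPzRingType) (f : R).

Definition principal : {pred R} := [pred x | `[< exists q, x = q * f >]].

Lemma principalP x : reflect (exists q, x = q * f) (x \in principal).
Proof. exact: asboolP. Qed.

Fact principal_zmod_closed : zmod_closed principal.
Proof.
split; first by apply/principalP; exists 0; rewrite mul0r.
move=> _ _ /principalP[q ->] /principalP[r ->].
by apply/principalP; exists (q - r); rewrite mulrBl.
Qed.
HB.instance Definition _ :=
  GRing.isZmodClosed.Build R principal principal_zmod_closed.

Lemma principal_mull x y : y \in principal -> x * y \in principal.
Proof.
by move=> /principalP[q ->]; apply/principalP; exists (x * q); rewrite mulrA.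
Qed.

Definition principal_quot : Type := Quotient.quot principal.
HB.instance Definition _ := GRing.Zmodule.on principal_quot.

Definition quot_pi (x : R) : principal_quot := \pi_(Quotient.quot principal) x.

Lemma quot_piP x y : quot_pi x = quot_pi y <-> x - y \in principal.
Proof.
by rewrite Quotient.idealrBE; split=> [/eqP|/eqP].
Qed.

Lemma quot_pi_surj (u : principal_quot) : exists x, quot_pi x = u.
Proof. by exists (repr (u : Quotient.quot principal)); apply: reprK. Qed.

Lemma quot_piB x y : quot_pi (x - y) = quot_pi x - quot_pi y.
Proof. by rewrite /quot_pi !piE. Qed.

Lemma quot_piD x y : quot_pi (x + y) = quot_pi x + quot_pi y.
Proof. by rewrite /quot_pi !piE. Qed.

Definition quot_mul (u v : principal_quot) : principal_quot :=
  quot_pi (repr (u : Quotient.quot principal)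
           * repr (v : Quotient.quot principal)).

Lemma quot_mulE x y : quot_mul (quot_pi x) (quot_pi y) = quot_pi (x * y).
Proof.
apply/quot_piP; set x' := repr _; set y' := repr _.
have hx : x' - x \in principal by apply/quot_piP/reprK.
have hy : y' - y \in principal by apply/quot_piP/reprK.
have -> : x' * y' - x * y = y' * (x' - x) + x * (y' - y).
  by rewrite !mulrBr [y' * x']mulrC [y' * x]mulrC addrA addrNK.
by rewrite rpredD ?principal_mull.
Qed.

Fact quot_mulA : associative quot_mul.
Proof.
move=> u v w; have [x <-] := quot_pi_surj u; have [y <-] := quot_pi_surj v.
by have [z <-] := quot_pi_surj w; rewrite !quot_mulE mulrA.
Qed.
Fact quot_mulC : commutative quot_mul.
Proof.
move=> u v; have [x <-] := quot_pi_surj u; have [y <-] := quot_pi_surj v.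
by rewrite !quot_mulE mulrC.
Qed.
Fact quot_mul1 : left_id (quot_pi 1) quot_mul.
Proof. by move=> u; have [x <-] := quot_pi_surj u; rewrite !quot_mulE mul1r. Qed.
Fact quot_mulD : left_distributive quot_mul +%R.
Proof.
move=> u v w; have [x <-] := quot_pi_surj u; have [y <-] := quot_pi_surj v.
have [z <-] := quot_pi_surj w.
by rewrite -quot_piD !quot_mulE mulrDl quot_piD.
Qed.
HB.instance Definition _ := GRing.Zmodule_isComPzRing.Build principal_quot
  quot_mulA quot_mulC quot_mul1 quot_mulD.

Fact quot_pi_zmod_morphism : zmod_morphism quot_pi.
Proof. exact: quot_piB. Qed.
HB.instance Definition _ :=
  GRing.isZmodMorphism.Build R principal_quot quot_pi quot_pi_zmod_morphism.
Fact quot_pi_monoid_morphism : monoid_morphism quot_pi.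
Proof. by split=> // x y; rewrite -quot_mulE. Qed.
HB.instance Definition _ :=
  GRing.isMonoidMorphism.Build R principal_quot quot_pi quot_pi_monoid_morphism.

End PrincipalQuotient.

Record mulset (R : comPzRingType) := MulSet {
  in_mulset :> R -> Prop;
  mulset1 : in_mulset 1;
  mulsetM : forall s t, in_mulset s -> in_mulset t -> in_mulset (s * t)
}.

Section Localization.
Variables (R : comPzRingType) (T : mulset R).

Definition frac_pair := {x : R * R | `[< T x.2 >]}.

Definition mk_frac_pair (a s : R) (Ts : T s) : frac_pair :=
  exist _ (a, s) (asboolT (Ts : T (a, s).2)).

Lemma frac_pairT (x : frac_pair) : T (\val x).2.
Proof. by case: x => x /= /asboolP. Qed.

Definition frac_eq : rel frac_pair := fun x y =>
  `[< exists2 t, T t &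
      t * ((\val x).1 * (\val y).2 - (\val y).1 * (\val x).2) = 0 >].

Fact frac_eq_equiv : equiv_class_of frac_eq.
Proof.
split=> [x|x y|y x z].
- by apply/asboolP; exists 1; [exact: mulset1|rewrite subrr mulr0].
- suff sub u v : frac_eq u v -> frac_eq v u by apply/idP/idP; apply: sub.
  move=> /asboolP[t Tt e]; apply/asboolP; exists t => //.
  by rewrite -opprB mulrN e oppr0.
- move=> /asboolP[t Tt e] /asboolP[u Tu e']; apply/asboolP.
  exists (t * u * (\val y).2).
    by apply: mulsetM (frac_pairT y); apply: mulsetM.
  move: (\val x) (\val y) (\val z) e e' => [a s] [b r] [c q] /= e e'.
  have -> : t * u * r * (a * q - c * s)
      = u * q * (t * (a * r - b * s)) + t * s * (u * (b * q - c * r)) by ring.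
  by rewrite e e' !mulr0 addr0.
Qed.
Canonical frac_eq_equiv_rel := EquivRelPack frac_eq_equiv.
Canonical frac_eq_encModRel := defaultEncModRel frac_eq.

Definition localization := {eq_quot frac_eq}.
HB.instance Definition _ := Choice.on localization.

Definition frac (a s : R) (Ts : T s) : localization :=
  \pi_({eq_quot frac_eq}) (mk_frac_pair a Ts).

Lemma fracP a b s r (Ts : T s) (Tr : T r) :
  frac a Ts = frac b Tr <-> exists2 t, T t & t * (a * r - b * s) = 0.
Proof.
split=> [/eqP|h]; first by rewrite /frac eqmodE => /asboolP.
by apply/eqP; rewrite /frac eqmodE; apply/asboolP.
Qed.

Lemma frac_surj (u : localization) : exists a s (Ts : T s), frac a Ts = u.
Proof.
rewrite -[u]reprK; case: (repr u) => -[a s] Ts.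
exists a, s, (elimT (asboolP _) Ts); rewrite /frac; congr (\pi _).
exact: val_inj.
Qed.

Lemma frac_eqI a b s r (Ts : T s) (Tr : T r) :
  a * r = b * s -> frac a Ts = frac b Tr.
Proof.
move=> e; apply/fracP; exists 1; first exact: mulset1.
by rewrite e subrr mulr0.
Qed.

Definition loc_num (u : localization) : R := (\val (repr u)).1.
Definition loc_den (u : localization) : R := (\val (repr u)).2.
Definition loc_denT u : T (loc_den u) := frac_pairT (repr u).

Lemma loc_numden u : frac (loc_num u) (loc_denT u) = u.
Proof.
rewrite -[RHS]reprK /frac; congr (\pi _); apply: val_inj.
by rewrite /= /loc_num /loc_den -surjective_pairing.
Qed.

Definition loc_add u v := frac
  (loc_num u * loc_den v + loc_num v * loc_den u)
  (mulsetM (loc_denT u) (loc_denT v)).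
Definition loc_opp u := frac (- loc_num u) (loc_denT u).
Definition loc_mul u v := frac (loc_num u * loc_num v)
  (mulsetM (loc_denT u) (loc_denT v)).

Lemma loc_addE a b s r (Ts : T s) (Tr : T r) :
  loc_add (frac a Ts) (frac b Tr) = frac (a * r + b * s) (mulsetM Ts Tr).
Proof.
have /fracP[t Tt et] := loc_numden (frac a Ts).
have /fracP[u Tu eu] := loc_numden (frac b Tr).
apply/fracP; exists (t * u); first exact: mulsetM.
move: et eu; set x := loc_num _; set y := loc_den _.
set x' := loc_num _; set y' := loc_den _ => et eu.
transitivity (u * y' * r * (t * (x * s - a * y))
  + t * y * s * (u * (x' * r - b * y'))); first by ring.
by rewrite et eu !mulr0 addr0.
Qed.

Lemma loc_oppE a s (Ts : T s) : loc_opp (frac a Ts) = frac (- a) Ts.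
Proof.
have /fracP[t Tt et] := loc_numden (frac a Ts).
apply/fracP; exists t => //; rewrite !mulNr -opprD mulrN.
by rewrite et oppr0.
Qed.

Lemma loc_mulE a b s r (Ts : T s) (Tr : T r) :
  loc_mul (frac a Ts) (frac b Tr) = frac (a * b) (mulsetM Ts Tr).
Proof.
have /fracP[t Tt et] := loc_numden (frac a Ts).
have /fracP[u Tu eu] := loc_numden (frac b Tr).
apply/fracP; exists (t * u); first exact: mulsetM.
move: et eu; set x := loc_num _; set y := loc_den _.
set x' := loc_num _; set y' := loc_den _ => et eu.
transitivity (u * x' * r * (t * (x * s - a * y))
  + t * a * y * (u * (x' * r - b * y'))); first by ring.
by rewrite et eu !mulr0 addr0.
Qed.

Let loc0 := frac 0 (mulset1 T).
Let loc1 := frac 1 (mulset1 T).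

Fact loc_addA : associative loc_add.
Proof.
move=> u v w; have [a [s [Ts <-]]] := frac_surj u.
have [b [r [Tr <-]]] := frac_surj v; have [c [q [Tq <-]]] := frac_surj w.
by rewrite !loc_addE; apply: frac_eqI; ring.
Qed.
Fact loc_addC : commutative loc_add.
Proof.
move=> u v; have [a [s [Ts <-]]] := frac_surj u.
have [b [r [Tr <-]]] := frac_surj v.
by rewrite !loc_addE; apply: frac_eqI; ring.
Qed.
Fact loc_add0 : left_id loc0 loc_add.
Proof.
move=> u; have [a [s [Ts <-]]] := frac_surj u.
by rewrite !loc_addE; apply: frac_eqI; ring.
Qed.
Fact loc_addN : left_inverse loc0 loc_opp loc_add.
Proof.
move=> u; have [a [s [Ts <-]]] := frac_surj u.
by rewrite loc_oppE !loc_addE; apply: frac_eqI; ring.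
Qed.
HB.instance Definition _ := GRing.isZmodule.Build localization
  loc_addA loc_addC loc_add0 loc_addN.

Fact loc_mulA : associative loc_mul.
Proof.
move=> u v w; have [a [s [Ts <-]]] := frac_surj u.
have [b [r [Tr <-]]] := frac_surj v; have [c [q [Tq <-]]] := frac_surj w.
by rewrite !loc_mulE; apply: frac_eqI; ring.
Qed.
Fact loc_mulC : commutative loc_mul.
Proof.
move=> u v; have [a [s [Ts <-]]] := frac_surj u.
have [b [r [Tr <-]]] := frac_surj v.
by rewrite !loc_mulE; apply: frac_eqI; ring.
Qed.
Fact loc_mul1 : left_id loc1 loc_mul.
Proof.
move=> u; have [a [s [Ts <-]]] := frac_surj u.
by rewrite !loc_mulE; apply: frac_eqI; ring.
Qed.
Fact loc_mulD : left_distributive loc_mul loc_add.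
Proof.
move=> u v w; have [a [s [Ts <-]]] := frac_surj u.
have [b [r [Tr <-]]] := frac_surj v; have [c [q [Tq <-]]] := frac_surj w.
by rewrite !(loc_mulE, loc_addE); apply: frac_eqI; ring.
Qed.
HB.instance Definition _ := GRing.Zmodule_isComPzRing.Build localization
  loc_mulA loc_mulC loc_mul1 loc_mulD.

Lemma frac0 : frac 0 (mulset1 T) = 0. Proof. by []. Qed.
Lemma frac1 : frac 1 (mulset1 T) = 1. Proof. by []. Qed.
Lemma fracD a b s r (Ts : T s) (Tr : T r) :
  frac a Ts + frac b Tr = frac (a * r + b * s) (mulsetM Ts Tr).
Proof. exact: loc_addE. Qed.
Lemma fracN a s (Ts : T s) : - frac a Ts = frac (- a) Ts.
Proof. exact: loc_oppE. Qed.
Lemma fracM a b s r (Ts : T s) (Tr : T r) :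
  frac a Ts * frac b Tr = frac (a * b) (mulsetM Ts Tr).
Proof. exact: loc_mulE. Qed.

End Localization.

Section DependentProduct.
Variables (I : Type) (R : I -> comPzRingType).

Definition dprod_ring := forall i, R i.
HB.instance Definition _ := Choice.on dprod_ring.

Let dp0 : dprod_ring := fun=> 0.
Let dp1 : dprod_ring := fun=> 1.
Let dpN (f : dprod_ring) : dprod_ring := fun i => - f i.
Let dpD (f g : dprod_ring) : dprod_ring := fun i => f i + g i.
Let dpM (f g : dprod_ring) : dprod_ring := fun i => f i * g i.

Fact dpDA : associative dpD.
Proof. by move=> f g h; apply: functional_extensionality_dep => i; apply: addrA. Qed.
Fact dpDC : commutative dpD.
Proof. by move=> f g; apply: functional_extensionality_dep => i; apply: addrC. Qed.
Fact dpD0 : left_id dp0 dpD.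
Proof. by move=> f; apply: functional_extensionality_dep => i; apply: add0r. Qed.
Fact dpDN : left_inverse dp0 dpN dpD.
Proof. by move=> f; apply: functional_extensionality_dep => i; apply: addNr. Qed.
HB.instance Definition _ := GRing.isZmodule.Build dprod_ring dpDA dpDC dpD0 dpDN.

Fact dpMA : associative dpM.
Proof. by move=> f g h; apply: functional_extensionality_dep => i; apply: mulrA. Qed.
Fact dpMC : commutative dpM.
Proof. by move=> f g; apply: functional_extensionality_dep => i; apply: mulrC. Qed.
Fact dpM1 : left_id dp1 dpM.
Proof. by move=> f; apply: functional_extensionality_dep => i; apply: mul1r. Qed.
Fact dpMD : left_distributive dpM dpD.
Proof. by move=> f g h; apply: functional_extensionality_dep => i; apply: mulrDl. Qed.
HB.instance Definition _ := GRing.Zmodule_isComPzRing.Build dprod_ring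
  dpMA dpMC dpM1 dpMD.

End DependentProduct.

HB.mixin Record isGraded S of GRing.ComPzRing S := {
  homog : nat -> S -> Prop;
  homog0 : forall d, homog d 0;
  homogB : forall d x y, homog d x -> homog d y -> homog d (x - y);
  homog1 : homog 0 1;
  homogM : forall d e x y, homog d x -> homog e y -> homog (d + e) (x * y);
  homog_decomp : forall x, exists n (c : nat -> S),
    (forall d, homog d (c d)) /\ x = \sum_(d < n) c d;
  homog_direct : forall n (c : nat -> S), (forall d, homog d (c d)) ->
    \sum_(d < n) c d = 0 -> forall d, (d < n)%N -> c d = 0
}.

#[short(type="gradedRingType")]
HB.structure Definition GradedRing := {S of isGraded S & GRing.ComPzRing S}.

Section GradedTheory.
Variable S : gradedRingType.

Lemma homogN d (x : S) : homog d x -> homog d (- x).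
Proof. by move=> hx; rewrite -sub0r; apply: homogB => //; apply: homog0. Qed.

Lemma homogD d (x y : S) : homog d x -> homog d y -> homog d (x + y).
Proof. by move=> hx hy; rewrite -[y]opprK; apply/homogB/homogN. Qed.

End GradedTheory.

Section Proj.
Variable S : gradedRingType.

(* Homogeneous ideals are those generated by homogeneous elements; containing   *)
(* the irrelevant ideal S_+ amounts to containing all homogeneous elements of   *)
(* positive degree.                                                             *)
Record proj_point (p : S -> Prop) : Prop := ProjPoint {
  proj_ideal0 : p 0;
  proj_idealD : forall x y, p x -> p y -> p (x + y);
  proj_idealM : forall x y, p y -> p (x * y);
  proj_prime1 : ~ p 1;
  proj_primeM : forall x y, p (x * y) -> p x \/ p y;
  proj_homog : forall x, p x -> exists n (c : nat -> S),
    (forall d, homog d (c d) /\ p (c d)) /\ x = \sum_(d < n) c d;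
  proj_relevant : ~ (forall d x, (0 < d)%N -> homog d x -> p x)
}.

Definition Proj : Type := {p : S -> Prop | proj_point p}.
HB.instance Definition _ := gen_eqMixin Proj.
HB.instance Definition _ := gen_choiceMixin Proj.

Definition in_point (p : Proj) : S -> Prop := sval p.
Lemma pointP p : proj_point (in_point p). Proof. exact: svalP. Qed.

(* The closed subsets are the loci V(E) = {p | E is contained in p}, for E a    *)
(* set of homogeneous elements.                                                 *)
Definition zariski_open (U : set Proj) : Prop :=
  exists E : S -> Prop, (forall x, E x -> exists d, homog d x) /\
    forall p, U p <-> ~ (forall x, E x -> in_point p x).

Fact zariski_openT : zariski_open setT.
Proof.
exists (fun x => exists2 d, (0 < d)%N & homog d x); split=> [x [d _ hx]|p].
  by exists d.
split=> // _ h; apply: (proj_relevant (pointP p)) => d x d0 hx.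
by apply: h; exists d.
Qed.

Fact zariski_openI : setI_closed zariski_open.
Proof.
move=> U V [E [hE UE]] [F [hF VF]].
exists (fun z => exists x y, [/\ E x, F y & z = x * y]); split.
  move=> _ [x [y [/hE[d hx] /hF[e hy] ->]]]; exists (d + e)%N.
  exact: homogM.
move=> p; split=> [[/UE + /VF]|h].
  move=> /existsNP[x /not_implyP[Ex px]] /existsNP[y /not_implyP[Fy py]] h.
  by case: (proj_primeM (pointP p) (h _ (ex_intro _ x (ex_intro _ y
    (And3 Ex Fy erefl))))).
by split; [apply/UE|apply/VF] => h'; apply: h => _ [x [y [Ex Fy ->]]];
  [rewrite mulrC|]; apply: (proj_idealM (pointP p)); apply: h'.
Qed.

Fact zariski_open_bigU (I : Type) (f : I -> set Proj) :
  (forall i, zariski_open (f i)) -> zariski_open (\bigcup_i f i).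
Proof.
move=> fo; exists (fun x => (exists d, homog d x) /\
  exists2 i, True & forall p, ~ in_point p x -> f i p); split=> [x []//|p].
split=> [[i _ fip] h|/existsNP[x /not_implyP[[_ [i _ fi]] px]]].
  have [E [hE fE]] := fo i.
  have /existsNP[x /not_implyP[Ex px]] := (fE p).1 fip.
  apply/px/h; split; first exact: hE.
  exists i => // q qx; apply/fE => h'; exact/qx/h'.
by exists i => //; apply: fi.
Qed.

HB.instance Definition _ := isOpenTopological.Build Proj
  zariski_openT zariski_openI zariski_open_bigU.

Definition homog_away (p : Proj) (g : S) : Prop :=
  (exists d, homog d g) /\ ~ in_point p g.

Fact homog_away1 p : homog_away p 1.
Proof. by split; [exists 0; apply: homog1|apply: proj_prime1 (pointP p)]. Qed.

Fact homog_awayM p g h : homog_away p g -> homog_away p h -> homog_away p (g * h).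
Proof.
move=> [[d hg] pg] [[e hh] ph]; split; first by exists (d + e)%N; apply: homogM.
by case/(proj_primeM (pointP p)).
Qed.

Definition homog_away_mulset p := MulSet (homog_away1 p) (@homog_awayM p).

(* The homogeneous localization S_(p) is the degree 0 part of this ring, and    *)
(* the stalk S(n)_(p) of the n-th twisting sheaf is its degree n part.          *)
Definition homog_loc (p : Proj) : comPzRingType :=
  localization (homog_away_mulset p).

Definition local_sections := dprod_ring homog_loc.

Definition is_section (n : nat) (s : local_sections) : Prop :=
  forall p : Proj, exists2 U : set Proj, open_nbhs p U &
    exists d (f g : S), [/\ homog (d + n) f, homog d g &
      forall q, U q -> exists gq : homog_away_mulset q g, s q = frac f gq].

Lemma is_sectionB n s t :
  is_section n s -> is_section n t -> is_section n (s - t).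
Proof.
move=> hs ht p; have [U Up [d [f [g [hf hg e]]]]] := hs p.
have [V Vp [d' [f' [g' [hf' hg' e']]]]] := ht p.
exists (U `&` V)%classic; first exact: open_nbhsI.
exists (d + d')%N, (f * g' - f' * g), (g * g'); split; last 2 first.
- exact: homogM.
- move=> q [/e[gq eq] /e'[gq' eq']]; exists (mulsetM gq gq').
  rewrite (_ : (s - t) q = s q - t q) // eq eq' fracN fracD.
  by rewrite mulNr.
apply: homogB; first by rewrite addnAC; apply: homogM.
by rewrite -addnA addnC; apply: homogM.
Qed.

Lemma is_sectionM m n s t :
  is_section m s -> is_section n t -> is_section (m + n) (s * t).
Proof.
move=> hs ht p; have [U Up [d [f [g [hf hg e]]]]] := hs p.
have [V Vp [d' [f' [g' [hf' hg' e']]]]] := ht p.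
exists (U `&` V)%classic; first exact: open_nbhsI.
exists (d + d')%N, (f * f'), (g * g'); split.
- by rewrite addnACA; apply: homogM.
- exact: homogM.
- move=> q [/e[gq eq] /e'[gq' eq']]; exists (mulsetM gq gq').
  by rewrite (_ : (s * t) q = s q * t q) // eq eq' fracM.
Qed.

Lemma is_section0 n : is_section n 0.
Proof.
move=> p; exists setT; first by split=> //; apply: openT.
exists 0, 0, 1; split=> [||q _]; [exact: homog0|exact: homog1|].
by exists (homog_away1 q).
Qed.

Lemma is_section1 : is_section 0 1.
Proof.
move=> p; exists setT; first by split=> //; apply: openT.
exists 0, 1, 1; split=> [||q _]; [exact: homog1|exact: homog1|].
by exists (homog_away1 q).
Qed.

Definition section_pred n : {pred local_sections} := fun s => `[< is_section n s >].

Lemma section_predP n s : reflect (is_section n s) (s \in section_pred n).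
Proof. exact: asboolP. Qed.

Definition structure_pred : {pred local_sections} := section_pred 0.

Fact structure_subring_closed : subring_closed structure_pred.
Proof.
split; first exact/section_predP/is_section1.
- by move=> s t /section_predP hs /section_predP ht;
     apply/section_predP/is_sectionB.
- by move=> s t /section_predP hs /section_predP ht;
     apply/section_predP/(@is_sectionM 0 0).
Qed.

(* The ring of global sections of the structure sheaf. *)
Definition structure_sections : Type := {s : local_sections | s \in structure_pred}.
HB.instance Definition _ := SubType.on structure_sections.
HB.instance Definition _ := [Choice of structure_sections by <:].
HB.instance Definition _ := GRing.SubChoice_isSubComPzRing.Build
  local_sections structure_pred structure_sections structure_subring_closed.

Fact section_zmod_closed n : zmod_closed (section_pred n).
Proof.
split; first exact/section_predP/is_section0.
by move=> s t /section_predP hs /section_predP ht;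
   apply/section_predP/is_sectionB.
Qed.

(* The module of global sections of the n-th twisting sheaf. *)
Definition twist_sections (n : nat) : Type := {s : local_sections | s \in section_pred n}.
HB.instance Definition _ n := SubType.on (twist_sections n).
HB.instance Definition _ n := [Choice of twist_sections n by <:].
HB.instance Definition _ n := GRing.SubChoice_isSubZmodule.Build
  local_sections (section_pred n) (twist_sections n) (section_zmod_closed n).

Fact twist_scale_subproof n (r : structure_sections) (s : twist_sections n) :
  \val r * \val s \in section_pred n.
Proof.
apply/section_predP/(@is_sectionM 0 n); first exact/section_predP/(valP r).
exact/section_predP/(valP s).
Qed.

Definition twist_scale n (r : structure_sections) (s : twist_sections n) : twist_sections n :=
  exist _ (\val r * \val s) (twist_scale_subproof r s).

Fact twist_scaleA n (r t : structure_sections) (s : twist_sections n) :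
  twist_scale r (twist_scale t s) = twist_scale (r * t) s.
Proof. by apply: val_inj; rewrite /= mulrA. Qed.
Fact twist_scale1 n : left_id (1 : structure_sections) (@twist_scale n).
Proof. by move=> s; apply: val_inj; rewrite /= mul1r. Qed.
Fact twist_scaleDr n : right_distributive (@twist_scale n) +%R.
Proof. by move=> r s t; apply: val_inj; rewrite /= mulrDr. Qed.
Fact twist_scaleDl n (s : twist_sections n) :
  {morph (@twist_scale n)^~ s : r t / r + t}.
Proof. by move=> r t; apply: val_inj; rewrite /= mulrDl. Qed.
HB.instance Definition _ n := GRing.Zmodule_isLmodule.Build structure_sections (twist_sections n)
  (@twist_scaleA n) (@twist_scale1 n) (@twist_scaleDr n) (@twist_scaleDl n).

End Proj.

(* A[X,Y] is the subring of A[[Y]][[X]] consisting of the power series with    *)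
(* finitely many nonzero coefficients; f i j is the coefficient of X^i Y^j.     *)

Definition series (R : comPzRingType) : Type := nat -> R.

Section Series.
Variable R : comPzRingType.
HB.instance Definition _ := GRing.Zmodule.copy (series R) (nat -> R).

Definition series_one : series R := fun n => if n is 0 then 1 else 0.
Definition series_mul (f g : series R) : series R :=
  fun n => \sum_(i < n.+1) f i * g (n - i)%N.

Fact series_mulC : commutative series_mul.
Proof.
move=> f g; apply: functional_extensionality_dep => n; rewrite /series_mul.
rewrite (reindex_inj rev_ord_inj) /=; apply: eq_bigr => i _.
by rewrite /= subSS subKn -1?ltnS // [RHS]mulrC.
Qed.

Fact series_mulA : associative series_mul.
Proof.
move=> f g h; apply: functional_extensionality_dep => n; rewrite /series_mul.
pose F j k := f j * (g k * h (n - (j + k))%N).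
transitivity (\sum_(j < n.+1) \sum_(k < n.+1 | (j + k <= n)%N) F j k).
  apply: eq_bigr => j _; rewrite big_distrr /= (big_ord_widen_cond n.+1
    xpredT (fun k => f j * (g k * h (n - j - k)%N))) ?ltnS ?leq_subr //.
  apply: eq_big => k; first by rewrite ltnS leq_subRL -1?ltnS.
  by rewrite /F subnDA.
transitivity (\sum_(m < n.+1) \sum_(j < n.+1 | (j <= m)%N)
    f j * g (m - j)%N * h (n - m)%N); last first.
  apply: eq_bigr => m _; rewrite big_distrl /= [RHS](big_ord_widen_cond n.+1
    xpredT (fun j => f j * g (m - j)%N * h (n - m)%N)) //.
rewrite [RHS](exchange_big_dep xpredT) //=; apply: eq_bigr => j _.
transitivity (\sum_(0 <= k < n.+1 | (j + k <= n)%N) F j k).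
  by rewrite big_mkord.
transitivity (\sum_(0 <= m < n.+1 | (j <= m)%N)
  f j * g (m - j)%N * h (n - m)%N); last by rewrite big_mkord.
transitivity (\sum_(j <= m < n.+1) f j * g (m - j)%N * h (n - m)%N); last first.
  by rewrite (big_nat_widenl j 0).
rewrite -[X in \sum_(X <= m < _) _]add0n big_addn (big_nat_widen 0 (n.+1 - j) n.+1) ?leq_subr //.
apply: eq_big => k /=; first by rewrite ltn_subRL ltnS.
by rewrite /F addnK [(k + j)%N]addnC mulrA.
Qed.

Fact series_mul1 : left_id series_one series_mul.
Proof.
move=> f; apply: functional_extensionality_dep => n.
rewrite /series_mul big_ord_recl /= mul1r subn0 big1 ?addr0 // => i _.
by rewrite mul0r.
Qed.

Fact series_mulD : left_distributive series_mul +%R.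
Proof.
move=> f g h; apply: functional_extensionality_dep => n.
rewrite /series_mul [RHS]/GRing.add /= -big_split /=; apply: eq_bigr => i _.
by rewrite -mulrDl.
Qed.
HB.instance Definition _ := GRing.Zmodule_isComPzRing.Build (series R)
  series_mulA series_mulC series_mul1 series_mulD.

Lemma coefsM (f g : series R) n :
  (f * g) n = \sum_(i < n.+1) f i * g (n - i)%N.
Proof. by []. Qed.

Lemma coefs_sum (I : Type) (r : seq I) (P : pred I) (F : I -> series R) n :
  (\sum_(i <- r | P i) F i) n = \sum_(i <- r | P i) F i n.
Proof. exact: (big_morph (fun f : series R => f n)). Qed.
End Series.

Section Bipoly.
Variable A : comPzRingType.

Definition finite_series : {pred series (series A)} :=
  fun f => `[< exists N, forall i j, (N <= i + j)%N -> f i j = 0 >].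

Lemma coefs2M (f g : series (series A)) i j : (f * g) i j =
  \sum_(k < i.+1) \sum_(l < j.+1) f k l * g (i - k)%N (j - l)%N.
Proof. by rewrite coefsM coefs_sum. Qed.

Fact finite_series_subring_closed : subring_closed finite_series.
Proof.
split.
- by apply/asboolP; exists 1 => -[|i] [|j].
- move=> f g /asboolP[M fM] /asboolP[N gN]; apply/asboolP.
  exists (M + N)%N => i j h; rewrite (_ : (f - g) i j = f i j - g i j) //.
  rewrite fM ?gN ?subr0 //.
    exact: leq_trans (leq_addl M N) h.
  exact: leq_trans (leq_addr N M) h.
- move=> f g /asboolP[M fM] /asboolP[N gN]; apply/asboolP.
  exists (M + N)%N => i j h; rewrite coefs2M big1 // => k _.
  rewrite big1 // => l _.
  have [hM|hM] := leqP M (k + l); first by rewrite fM ?mul0r.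
  rewrite gN ?mulr0 //; move: hM h (ltn_ord k) (ltn_ord l).
  by clear; lia.
Qed.

Definition bipoly : Type := {f : series (series A) | f \in finite_series}.
HB.instance Definition _ := SubType.on bipoly.
HB.instance Definition _ := [Choice of bipoly by <:].
HB.instance Definition _ := GRing.SubChoice_isSubComPzRing.Build
  (series (series A)) finite_series bipoly finite_series_subring_closed.

(* The coefficient of X^i Y^j. *)
Definition coef2 (P : bipoly) (i j : nat) : A := \val P i j.

Lemma bipolyP P Q : (forall i j, coef2 P i j = coef2 Q i j) -> P = Q.
Proof.
move=> h; apply: val_inj; apply: functional_extensionality_dep => i.
apply: functional_extensionality_dep => j; exact: h.
Qed.

Lemma coef2_0 i j : coef2 0 i j = 0. Proof. by []. Qed.
Lemma coef2_1 i j : coef2 1 i j = ((i == 0) && (j == 0))%:R.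
Proof. by case: i j => [|i] [|j]. Qed.
Lemma coef2B P Q i j : coef2 (P - Q) i j = coef2 P i j - coef2 Q i j.
Proof. by []. Qed.
Lemma coef2D P Q i j : coef2 (P + Q) i j = coef2 P i j + coef2 Q i j.
Proof. by []. Qed.
Lemma coef2M P Q i j : coef2 (P * Q) i j =
  \sum_(k < i.+1) \sum_(l < j.+1) coef2 P k l * coef2 Q (i - k)%N (j - l)%N.
Proof. exact: coefs2M. Qed.
Lemma coef2_sum (I : Type) (r : seq I) (p : pred I) (F : I -> bipoly) i j :
  coef2 (\sum_(k <- r | p k) F k) i j = \sum_(k <- r | p k) coef2 (F k) i j.
Proof. exact: (big_morph (fun P => coef2 P i j)). Qed.

Lemma coef2_finite P : exists N, forall i j, (N <= i + j)%N -> coef2 P i j = 0.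
Proof. exact: (elimT (asboolP _) (valP P)). Qed.

Lemma mk_bipoly_subproof (N : nat) (c : nat -> nat -> A) :
  ((fun i j => if (i + j < N)%N then c i j else 0) : series (series A))
    \in finite_series.
Proof. by apply/asboolP; exists N => i j; rewrite ltnNge => ->. Qed.

(* The sum of c i j * X^i Y^j over i + j < N. *)
Definition mk_bipoly N c : bipoly :=
  exist (fun f => f \in finite_series) _ (mk_bipoly_subproof N c).

Lemma coef2_mk N c i j :
  coef2 (mk_bipoly N c) i j = if (i + j < N)%N then c i j else 0.
Proof. by []. Qed.

Definition bipolyC (c : A) : bipoly := mk_bipoly 1 (fun _ _ => c).
Definition bipolyX : bipoly := mk_bipoly 2 (fun i j => (i == 1)%:R).
Definition bipolyY : bipoly := mk_bipoly 2 (fun i j => (j == 1)%:R).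

(* The sum ranges over finitely many nonzero terms. *)
Definition eval2 (P : bipoly) (u v : A) : A :=
  \sum_(m \in [set: nat * nat]) coef2 P m.1 m.2 * u ^+ m.1 * v ^+ m.2.

Definition homog2 (d : nat) (P : bipoly) : Prop :=
  forall i j, (i + j)%N != d -> coef2 P i j = 0.

Fact homog2_0 d : homog2 d 0.
Proof. by move=> i j _; rewrite coef2_0. Qed.
Fact homog2B d P Q : homog2 d P -> homog2 d Q -> homog2 d (P - Q).
Proof. by move=> hP hQ i j h; rewrite coef2B hP // hQ // subr0. Qed.
Fact homog2_1 : homog2 0 1.
Proof. by move=> [|i] [|j]. Qed.
Fact homog2M d e P Q : homog2 d P -> homog2 e Q -> homog2 (d + e) (P * Q).
Proof.
move=> hP hQ i j h; rewrite coef2M big1 // => k _; rewrite big1 // => l _.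
have [hk|hk] := eqVneq (k + l)%N d; last by rewrite hP ?mul0r.
rewrite hQ ?mulr0 //; apply: contraNneq h => he.
by apply/eqP; move: hk he (ltn_ord k) (ltn_ord l); clear; lia.
Qed.
Fact homog2_decomp P : exists n (c : nat -> bipoly),
  (forall d, homog2 d (c d)) /\ P = \sum_(d < n) c d.
Proof.
have [N hN] := coef2_finite P.
exists N, (fun d => mk_bipoly N
  (fun i j => if (i + j)%N == d then coef2 P i j else 0)).
split=> [d i j /negPf h|]; first by rewrite coef2_mk h if_same.
apply: bipolyP => i j; rewrite coef2_sum.
have [h|h] := ltnP (i + j) N; last first.
  by rewrite hN // big1 // => d _; rewrite coef2_mk ltnNge h.
rewrite (bigD1 (Ordinal h)) //= coef2_mk h eqxx big1 ?addr0 // => d.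
by rewrite coef2_mk -val_eqE /= eq_sym => /negPf ->; rewrite if_same.
Qed.
Fact homog2_direct n (c : nat -> bipoly) : (forall d, homog2 d (c d)) ->
  \sum_(d < n) c d = 0 -> forall d, (d < n)%N -> c d = 0.
Proof.
move=> hc e d dn; apply: bipolyP => i j; rewrite coef2_0.
have [h|h] := eqVneq (i + j)%N d; last exact: hc.
have := congr1 (fun P => coef2 P i j) e.
rewrite coef2_0 coef2_sum (bigD1 (Ordinal dn)) //= big1 ?addr0 // => k kd.
by apply: hc; rewrite h eq_sym -val_eqE in kd *.
Qed.
HB.instance Definition _ := isGraded.Build bipoly homog2_0 homog2B homog2_1
  homog2M homog2_decomp homog2_direct.

End Bipoly.

Section QuotientGrading.
Variables (S : gradedRingType) (f : S).

Definition quot_homog (d : nat) (u : principal_quot f) : Prop :=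
  exists2 x : S, homog d x & u = quot_pi f x.

Fact quot_homog0 d : quot_homog d 0.
Proof. by exists 0; [exact: homog0|rewrite rmorph0]. Qed.
Fact quot_homogB d u v : quot_homog d u -> quot_homog d v -> quot_homog d (u - v).
Proof.
move=> [x hx ->] [y hy ->]; exists (x - y); first exact: homogB.
by rewrite rmorphB.
Qed.
Fact quot_homog1 : quot_homog 0 1.
Proof. by exists 1; [exact: homog1|rewrite rmorph1]. Qed.
Fact quot_homogM d e u v :
  quot_homog d u -> quot_homog e v -> quot_homog (d + e) (u * v).
Proof.
move=> [x hx ->] [y hy ->]; exists (x * y); first exact: homogM.
by rewrite rmorphM.
Qed.
Fact quot_homog_decomp u : exists n (c : nat -> principal_quot f),
  (forall d, quot_homog d (c d)) /\ u = \sum_(d < n) c d.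
Proof.
have [x <-] := quot_pi_surj u; have [n [c [hc ->]]] := homog_decomp x.
exists n, (fun d => quot_pi f (c d)); split=> [d|]; first by exists (c d).
by rewrite rmorph_sum.
Qed.

Fact quot_homog_direct k n (c : nat -> principal_quot f) : homog k f ->
  (forall d, quot_homog d (c d)) ->
  \sum_(d < n) c d = 0 -> forall d, (d < n)%N -> c d = 0.
Proof.
move=> hf /(_ _)/cid2-/all_sig2[x hx cx] e d dn.
have /quot_piP : quot_pi f (\sum_(d < n) x d) = quot_pi f 0.
  by rewrite rmorph_sum rmorph0 -[RHS]e; apply: eq_bigr => i _; rewrite cx.
rewrite subr0 => /principalP[q].
have [m [p [hp ->]]] := homog_decomp q; rewrite mulr_suml => e'.
pose r i : S := (if (i < n)%N then x i else 0)
  - (if (k <= i < m + k)%N then p (i - k)%N * f else 0).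
have hr i : homog i (r i).
  apply: homogB; case: ifP => [h|_]; [exact: hx|exact: homog0| |exact: homog0].
  by case/andP: h => ki _; rewrite -{1}(subnK ki); apply: homogM.
have sr : \sum_(i < n + (m + k)) r i = 0.
  rewrite sumrB -[X in X - _]big_mkcond -[X in _ - X]big_mkcond /=.
  rewrite -(big_ord_widen _ x) ?leq_addr // e'; apply/eqP; rewrite subr_eq0.
  apply/eqP; transitivity (\sum_(k <= i < m + k) p (i - k)%N * f).
    rewrite -[X in \sum_(X <= i < _) _]add0n big_addn addnK big_mkord.
    by apply: eq_bigr => i _; rewrite addnK.
  rewrite (big_nat_widenl k 0) // (big_nat_widen 0 _ (n + (m + k))).
    by rewrite big_mkord; apply: eq_bigl.
  exact: leq_addl.
have /eqP : r d = 0 by rewrite (homog_direct _ _ hr sr _ (ltn_addr _ dn)).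
rewrite /r dn subr_eq0 => /eqP xd; rewrite cx -(rmorph0 (quot_pi f)).
apply/quot_piP; rewrite subr0 xd; case: ifP => _; last exact: rpred0.
by apply/principalP; exists (p (d - k)%N).
Qed.

End QuotientGrading.

Section GoodPoints.
Variable A : comPzRingType.

Definition Axy_relation (a b : A) : bipoly A :=
  bipolyX A * (bipolyC a * bipolyY A - bipolyC b * bipolyX A).

Definition Axy (a b : A) : Type := principal_quot (Axy_relation a b).
HB.instance Definition _ a b := GRing.ComPzRing.on (Axy a b).

Fact Axy_relation_homog (a b : A) : homog 2 (Axy_relation a b).
Proof.
have hX : homog 1 (bipolyX A).
  by move=> [|[|i]] [|j] // _; rewrite coef2_mk /= if_same.
have hY : homog 1 (bipolyY A).
  by move=> [|i] [|[|j]] // _; rewrite coef2_mk ?addnS //= if_same.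
have hC c : homog 0 (bipolyC c) by move=> [|i] [|j].
by apply: (homogM 1 1) => //; apply: homogB; apply: (homogM 0 1).
Qed.

HB.instance Definition _ a b := isGraded.Build (Axy a b)
  (@quot_homog0 _ (Axy_relation a b)) (@quot_homogB _ (Axy_relation a b))
  (@quot_homog1 _ (Axy_relation a b)) (@quot_homogM _ (Axy_relation a b))
  (@quot_homog_decomp _ (Axy_relation a b))
  (fun n c => @quot_homog_direct _ (Axy_relation a b) 2 n c (Axy_relation_homog a b)).

Definition primitive_point (a b : A) : Prop :=
  forall c : A, exists u v : A, c = a * u + b * v.

Definition good_point (a b : A) : Prop :=
  primitive_point a b /\
  exists N, (1 <= N)%N /\ exists l : A, is_unit (b ^+ N + l * a).

End GoodPoints.

(* Main.v *)
(* Two copies of Spec A sit in S(a,b): the points where x vanishes, with          *)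
(* coordinates (0,1), and those where ay - bx vanishes, with coordinates (a,b).   *)
(* Every point of S(a,b) lies on one of them, and they meet exactly above V(a).   *)
(* If au + bv = 1, an explicit pair of sections of O(-1) shows that               *)
(* O(1) (x) O(k) = O(k+1) already on global sections; hence O(1) is torsion iff   *)
(* some O(n), n > 0, has a generator s.  The restrictions z and w of s to the two *)
(* copies are units of A, and comparing them above V(a) gives w = b^n z mod a,    *)
(* that is, a unit of the form b^n + l a.  Conversely b^n + l a is the value at   *)
(* (a,b) of P = Y^n + l X (uX + vY)^(n-1), which takes the value 1 at (0,1); a P  *)
(* with unit values at both points vanishes nowhere and so generates O(n).        *)

Require Import Defs.
From HB Require Import structures.
From mathcomp Require Import all_boot all_order all_algebra.
From mathcomp Require Import boolp classical_sets fsbigop.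
From mathcomp Require Import topology_structure zify ring.

Set Implicit Arguments.
Unset Strict Implicit.
Unset Printing Implicit Defensive.

Import Defs GRing.Theory.
Local Open Scope ring_scope.

(** * Prime ideals and gluing over Spec A *)

(** Torsion is first turned into freeness. Over a non-affine scheme global sections need not commute
    with tensor products, but [twist_sections_tensor] gives O(m)(S) ⊗ O(n)(S) = O(m+n)(S) as soon as
    1 is a finite sum of products of sections of O(m) and O(-m); [twist_sections_tensor_of_relation]
    finds such sections for m = 1. By [tensor_power_twist] the n-th tensor power of O(1)(S) is then
    O(n)(S), so torsion says that some O(n)(S), n > 0, is isomorphic to the ring of global
    functions.

    From torsion to good ([good_point_of_torsion]), a generator s of O(n)(S) is pulled back along
    the two maps Spec A → S(a,b) by [restriction], which glues local fractions into elements z and w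
    of A ([affine_gluing]); both are units by [restriction_unit]. The congruence of w and b^n z
    modulo a is checked prime by prime through [ideal_eq1]. At a prime containing a the two image
    points coincide, and [heval_congr], that is P(a,b) = b^d P(0,1) mod a, compares the two
    pullbacks.

    Conversely [poly_of_good_point] writes down P, and [torsion_twist_of_poly] shows through
    [unit_notin_point] that P vanishes nowhere on S(a,b), so that it trivialises O(d). *)

Section PrimeIdeals.
Variable A : comPzRingType.
Implicit Types (I J q : A -> Prop).

Record ideal I : Prop := Ideal {
  ideal0 : I 0;
  idealD : forall x y, I x -> I y -> I (x + y);
  idealM : forall x y, I y -> I (x * y)
}.

Record prime_ideal q : Prop := PrimeIdeal {
  prime_idealP :> ideal q;
  prime_ideal1 : ~ q 1;
  prime_idealM : forall x y, q (x * y) -> q x \/ q y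
}.

Lemma prime_idealX q x n : prime_ideal q -> q (x ^+ n) -> q x.
Proof.
move=> hq; elim: n => [|n IHn]; first by move/(prime_ideal1 hq).
by rewrite exprS => /(prime_idealM hq)[|/IHn].
Qed.

Lemma prime_ideal_avoids (T : mulset A) I : ideal I ->
  (forall x, I x -> ~ T x) ->
  exists q, [/\ prime_ideal q, forall x, I x -> q x & forall x, q x -> ~ T x].
Proof.
move=> hI IT.
pose good J := [/\ ideal J, forall x, I x -> J x & forall x, J x -> ~ T x].
have [F FP Fchain|q [[q0|[hq Iq qT]] qmax]] :=
    @Zorn_bigcup A (fun J => J = set0 \/ good J).
- have [[J0 FJ0 [x0 J0x0]]|F0] := pselect (exists2 J, F J & exists x, J x).
  + have Fgood J x : F J -> J x -> good J.
      by move=> /FP[->|//]; case.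
    right; split; first split.
    * by exists J0 => //; case: (Fgood _ _ FJ0 J0x0) => -[].
    * move=> x y [J FJ Jx] [K FK Ky].
      have [JK|KJ] := Fchain _ _ FJ FK.
        exists K => //; have [hK _ _] := Fgood _ _ FK Ky.
        by apply: (idealD hK) => //; apply: JK.
      exists J => //; have [hJ _ _] := Fgood _ _ FJ Jx.
      by apply: (idealD hJ) => //; apply: KJ.
    * move=> x y [J FJ Jy]; exists J => //.
      by have [hJ _ _] := Fgood _ _ FJ Jy; apply: (idealM hJ).
    * by move=> x Ix; exists J0 => //; case: (Fgood _ _ FJ0 J0x0) => _ + _; apply.
    * by move=> x [J FJ Jx]; case: (Fgood _ _ FJ Jx) => _ _; apply.
  + left; rewrite -subset0 => x [J FJ Jx].
    by case: F0; exists J => //; exists x.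
- case: (qmax I); last by right; split.
  rewrite q0; split; first exact: sub0set.
  by move=> /(_ 0 (ideal0 hI)).
- exists q; split=> //; split=> //; first by move=> /qT; apply; apply: mulset1.
  (* By maximality the ideal generated by [q] and [x] meets [T]. *)
  have adjoin x : ~ q x -> exists2 t, T t & exists c, q (t - c * x).
    move=> qx; apply: contrapT => h.
    pose J z := exists c, q (z - c * x).
    have qJ z : q z -> J z by exists 0; rewrite mul0r subr0.
    case: (qmax J).
      split; first exact: qJ.
      move=> /(_ x); apply: contra_not qx; apply.
      by exists 1; rewrite mul1r subrr; apply: (ideal0 hq).
    right; split; first split.
    + exact/qJ/(ideal0 hq).
    + move=> y z [c hc] [d hd]; exists (c + d).
      by rewrite mulrDl opprD addrACA; apply: (idealD hq).
    + move=> y z [c hc]; exists (y * c).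
      by rewrite -mulrA -mulrBr; apply: (idealM hq).
    + by move=> z /Iq /qJ.
    + by move=> z [c hc] Tz; apply: h; exists z => //; exists c.
  move=> x y qxy; apply: contrapT => /not_orP[/adjoin[t Tt [c hc]] /adjoin[u Tu [d hd]]].
  apply: (qT (t * u)); last exact: mulsetM.
  have -> : t * u = u * (t - c * x) + c * x * (u - d * y) + c * d * (x * y).
    by ring.
  by apply: (idealD hq); first apply: (idealD hq); apply: (idealM hq).
Qed.

(** This is the local-to-global principle of the file: [I] is taken to be the set of multipliers
    after which a wanted property holds, so one multiplier outside each prime yields the property
    itself. *)
Lemma ideal_eq1 I : ideal I ->
  (forall q, prime_ideal q -> exists2 x, ~ q x & I x) -> I 1.
Proof.
move=> hI h; apply: contrapT => I1.
have oneM (s t : A) : 1 = s -> 1 = t -> 1 = s * t by move=> <- <-; rewrite mulr1.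
have [|q [hq Iq _]] := @prime_ideal_avoids (MulSet erefl oneM) I hI.
  by move=> x Ix /= x1; apply: I1; rewrite x1.
by have [x qx /Iq] := h q hq.
Qed.

Lemma is_unit_local x : (forall q, prime_ideal q -> ~ q x) -> is_unit x.
Proof.
move=> h; suff [y /esym] : exists y, 1 = x * y by exists y.
apply: (@ideal_eq1 (fun z => exists y, z = x * y)).
  split=> [|_ _ [y ->] [z ->]|z _ [y ->]].
  - by exists 0; rewrite mulr0.
  - by exists (y + z); rewrite mulrDr.
  - by exists (z * y); rewrite mulrCA.
by move=> q /h qx; exists x => //; exists 1; rewrite mulr1.
Qed.

(** Otherwise some prime would contain the annihilator of [z] and avoid the powers of [h], against
    the hypothesis at that prime. *)
Lemma annihilated_local (h z : A) :
  (forall q, prime_ideal q -> ~ q h -> exists2 t, ~ q t & t * z = 0) ->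
  exists N, h ^+ N * z = 0.
Proof.
move=> hz; apply: contrapT => noN.
have T1 : exists n, 1 = h ^+ n by exists 0.
have TM s t : (exists n, s = h ^+ n) -> (exists n, t = h ^+ n) ->
    exists n, s * t = h ^+ n.
  by move=> [m ->] [n ->]; exists (m + n)%N; rewrite exprD.
have [||q [hq Iq qT]] := @prime_ideal_avoids (MulSet T1 TM) (fun c => c * z = 0).
- split=> [|x y xz yz|x y yz]; first exact: mul0r.
    by rewrite mulrDl xz yz addr0.
  by rewrite -mulrA yz mulr0.
- by move=> x xz [n xn]; apply: noN; exists n; rewrite -xn.
have [|t qt /Iq//] := hz q hq; move=> qh; apply: (qT _ qh).
by exists 1; rewrite expr1.
Qed.

Lemma prime_ideal_sum1 (I : eqType) (l : seq I) (F : I -> A) q :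
  prime_ideal q -> \sum_(i <- l) F i = 1 -> exists2 i, i \in l & ~ q (F i).
Proof.
move=> hq sum_l; apply: contrapT => h; apply: (prime_ideal1 hq).
have qF i : i \in l -> q (F i).
  by move=> li; apply: contrapT => qi; apply: h; exists i.
rewrite -sum_l big_seq; elim/big_rec: _ => [|i x li qx]; first exact: (ideal0 hq).
by apply: (idealD hq) => //; apply: qF.
Qed.

(* [E f g] says that the section to be glued equals [f / g] on D(g). *)
Lemma affine_gluing (E : A -> A -> Prop) :
  (forall c f g, E f g -> E (c * f) (c * g)) ->
  (forall q, prime_ideal q -> exists f g, E f g /\ ~ q g) ->
  (forall f g f' g' q, E f g -> E f' g' -> prime_ideal q -> ~ q g -> ~ q g' ->
     exists2 t, ~ q t & t * (f * g' - f' * g) = 0) ->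
  exists z, forall q, prime_ideal q ->
    exists f g, [/\ E f g, ~ q g & exists2 t, ~ q t & t * (f - z * g) = 0].
Proof.
move=> Escale Ecover Ecompat.
have [l [El /esym sum_l]] : exists l : seq (A * A),
    (forall u, u \in l -> E u.1 u.2) /\ 1 = \sum_(u <- l) u.2.
  apply: (@ideal_eq1 (fun c => exists l : seq (A * A),
    (forall u, u \in l -> E u.1 u.2) /\ c = \sum_(u <- l) u.2)).
  - split=> [|_ _ [l [El ->]] [m [Em ->]]|c _ [l [El ->]]].
    + by exists [::]; rewrite big_nil.
    + exists (l ++ m); rewrite big_cat; split=> // u.
      by rewrite mem_cat => /orP[/El|/Em].
    + exists [seq (c * u.1, c * u.2) | u <- l]; rewrite big_map -big_distrr.
      by split=> // _ /mapP[u /El Eu ->]; apply: Escale.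
  - move=> q /Ecover[f [g [Efg qg]]]; exists g => //; exists [:: (f, g)].
    by rewrite big_seq1; split=> // u; rewrite inE => /eqP ->.
(* In place of a partition of unity: the [c] for which [c] times the section is given by a global
   element [z] form an ideal, and this ideal contains 1. *)
have [z hz] : exists z, forall u, u \in l ->
    exists N, u.2 ^+ N * (1 * u.1 - z * u.2) = 0.
  apply: (@ideal_eq1 (fun c => exists z, forall u, u \in l ->
    exists N, u.2 ^+ N * (c * u.1 - z * u.2) = 0)).
  - split=> [|c d [y hy] [z hz]|c d [z hz]].
    + by exists 0 => u _; exists 0; rewrite !mul0r subrr mulr0.
    + exists (y + z) => u lu; have [M eM] := hy u lu; have [N eN] := hz u lu.
      exists (M + N)%N; rewrite exprD.
      transitivity (u.2 ^+ N * (u.2 ^+ M * (c * u.1 - y * u.2))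
        + u.2 ^+ M * (u.2 ^+ N * (d * u.1 - z * u.2))); first by ring.
      by rewrite eM eN !mulr0 addr0.
    + exists (c * z) => u lu; have [N eN] := hz u lu; exists N.
      transitivity (c * (u.2 ^+ N * (d * u.1 - z * u.2))); first by ring.
      by rewrite eN mulr0.
  - move=> q hq; have [v lv qv] := prime_ideal_sum1 hq sum_l.
    (* The list is finite, so one exponent serves for all overlaps with [v]. *)
    have [N hN] : exists N, {in l, forall u : A * A,
        (u.2 * v.2) ^+ N * (u.1 * v.2 - v.1 * u.2) = 0}.
      have hv u : u \in l ->
          exists N, (u.2 * v.2) ^+ N * (u.1 * v.2 - v.1 * u.2) = 0.
        move=> lu; apply: annihilated_local => p hp puv.
        apply: (Ecompat _ _ _ _ _ (El u lu) (El v lv) hp).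
          by apply: contra_not puv => pu; rewrite mulrC; apply: (idealM hp).
        by apply: contra_not puv => pv; apply: (idealM hp).
      elim: (l) hv => [|u m IHm] hv; first by exists 0.
      have [|N hN] := IHm; first by move=> w mw; apply: hv; rewrite inE mw orbT.
      have [|M hM] := hv u; first exact: mem_head.
      exists (M + N)%N => w; rewrite inE exprD => /orP[/eqP ->|mw].
        by rewrite mulrAC hM mul0r.
      by rewrite -mulrA hN ?mulr0.
    (* The section is [v.1 / v.2] on D([v.2]), so its product with [v.2 ^+ N.+1] should be the
       global element [v.2 ^+ N * v.1]. *)
    exists (v.2 ^+ N.+1); first by move=> /(prime_idealX hq).
    exists (v.2 ^+ N * v.1) => u /hN e; exists N; rewrite -[RHS]e exprMn exprSr.
    by ring.
exists z => q hq; have [u lu qu] := prime_ideal_sum1 hq sum_l.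
have [N eN] := hz u lu; exists u.1, u.2; split=> //; first exact: El.
exists (u.2 ^+ N); first by move=> /(prime_idealX hq).
by rewrite -[u.1]mul1r.
Qed.

End PrimeIdeals.

(** * Tensor products *)

Section TensorProducts.
Variable R : comPzRingType.
Implicit Types M N T : lmodType R.

Lemma linear_of M N (f : M -> N) : linear f -> {g : {linear M -> N} | g =1 f}.
Proof.
move=> hf; pose fL := GRing.isLinear.Build R M N *:%R f hf.
by exists (HB.pack_for {linear M -> N} f fL).
Qed.

Lemma module_iso_refl M : module_iso M M.
Proof. by exists idfun; exists idfun. Qed.

Lemma module_iso_sym M N : module_iso M N -> module_iso N M.
Proof.
move=> [f [g fK gK]].
have [|h hg] := @linear_of N M g.
  by move=> c u v; apply: (can_inj fK); rewrite linearP !gK.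
by exists h; exists f => u; rewrite hg ?fK ?gK.
Qed.

Lemma module_iso_trans M N T : module_iso M N -> module_iso N T -> module_iso M T.
Proof. by move=> [f fbij] [g gbij]; exists (g \o f); apply: bij_comp. Qed.

Lemma tensor_product_iso M N N' T T' : module_iso N' N -> module_iso T T' ->
  is_tensor_product M N T -> is_tensor_product M N' T'.
Proof.
move=> [e [e' eK e'K]] [f [f' fK f'K]] [t [[tr tl] tU]].
have [|i hi] := @linear_of N N' e'.
  by move=> c u v; apply: (can_inj eK); rewrite linearP !e'K.
have [|j hj] := @linear_of T' T f'.
  by move=> c u v; apply: (can_inj fK); rewrite linearP !f'K.
exists (fun m n => f (t m (e n))); split; first split.
- by move=> m c u v; rewrite !linearP tr linearP.
- by move=> n c u v; rewrite tl linearP.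
move=> P h [hr hl]; have [|g [gt gU]] := tU P (fun m n => h m (i n)).
  split=> [m|n] c u v; last exact: hl.
  by rewrite linearP hr.
exists (g \o j); split=> [m n|g' g't u].
  by rewrite /= hj fK gt hi eK.
rewrite /= -[in LHS](f'K u) hj; apply: (gU (g' \o f)) => m n /=.
by rewrite -[n in LHS]e'K g't hi.
Qed.

Lemma tensor_product_unique M N T T' :
  is_tensor_product M N T -> is_tensor_product M N T' -> module_iso T T'.
Proof.
move=> [t [tb tU]] [t' [tb' tU']].
have [f [ft _]] := tU T' t' tb'; have [g [gt _]] := tU' T t tb.
have [h [_ hU]] := tU T t tb; have [h' [_ hU']] := tU' T' t' tb'.
exists f; exists g => u.
  have -> : g (f u) = h u.
    by apply: (hU (g \o f)) => m n /=; rewrite ft gt.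
  by symmetry; apply: (hU idfun).
have -> : f (g u) = h' u.
  by apply: (hU' (f \o g)) => m n /=; rewrite gt ft.
by symmetry; apply: (hU' idfun).
Qed.

(* The x i and c i form a finite dual basis of M; h i plays the part of the      *)
(* contraction of T = M (x) N against the i-th coordinate form.                *)
Lemma tensor_product_dual_basis M N T (t : M -> N -> T) (k : nat)
    (x : 'I_k -> M) (c : 'I_k -> M -> R) (h : 'I_k -> T -> N) :
  bilinear_map t -> (forall i, linear (h i)) ->
  (forall m, \sum_i c i m *: x i = m) ->
  (forall i m n, h i (t m n) = c i m *: n) ->
  (forall u, \sum_i t (x i) (h i u) = u) ->
  is_tensor_product M N T.
Proof.
move=> tb hlin xc ht tx; exists t; split=> // P f [fr fl].
have [|g hg] := @linear_of T P (fun u => \sum_i f (x i) (h i u)).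
  move=> d u v; rewrite scaler_sumr -big_split /=.
  by apply: eq_bigr => i _; rewrite hlin fr.
exists g; split=> [m n|g' g't u].
  have [F hF] := linear_of (fl n); rewrite hg -[m in RHS]xc -hF linear_sum.
  apply: eq_bigr => i _; have [G hG] := linear_of (fr (x i)).
  by rewrite ht linearZ /= hF -!hG linearZ.
rewrite hg -[in LHS](tx u) linear_sum.
by apply: eq_bigr => i _; rewrite g't.
Qed.

End TensorProducts.

(** * Sections of the twisting sheaves *)

Section Sections.
Variable S : gradedRingType.
Implicit Types (p : Proj S) (s : local_sections S).

Lemma open_nbhs_homog p d (g : S) :
  homog d g -> ~ in_point p g -> open_nbhs p [set q : Proj S | ~ in_point q g]%classic.
Proof.
move=> hg pg; split=> //; exists (eq g); split=> [_ <-|q]; first by exists d.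
split=> [qg h|h qg]; first exact/qg/h.
by apply: h => _ <-.
Qed.

Definition homog_section (h : S) : local_sections S :=
  fun p => frac h (mulset1 (homog_away_mulset p)).

Lemma homog_sectionP n h : homog n h -> is_section n (homog_section h).
Proof.
move=> hh p; exists setT; first by split=> //; apply: openT.
exists 0%N, h, 1; split=> // [|q _]; first exact: homog1.
by exists (mulset1 (homog_away_mulset q)).
Qed.

(* The global sections of the twisting sheaf of degree -n. *)
Definition is_cosection (n : nat) s : Prop :=
  forall p, exists2 U : set (Proj S), open_nbhs p U &
    exists d (f g : S), [/\ homog d f, homog (d + n) g &
      forall q, U q -> exists gq : homog_away_mulset q g, s q = frac f gq].

Lemma is_section_cosectionM m n s t :
  is_cosection m s -> is_section (m + n) t -> is_section n (s * t).
Proof.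
move=> hs ht p; have [U Up [d [f [g [hf hg e]]]]] := hs p.
have [V Vp [d' [f' [g' [hf' hg' e']]]]] := ht p.
exists (U `&` V)%classic; first exact: open_nbhsI.
exists (d + m + d')%N, (f * f'), (g * g'); split.
- have -> : (d + m + d' + n = d + (d' + (m + n)))%N by lia.
  exact: homogM.
- exact: homogM.
- move=> q [/e[gq eq] /e'[gq' eq']]; exists (mulsetM gq gq').
  by rewrite (_ : (s * t) q = s q * t q) // eq eq' fracM.
Qed.

Definition mk_section n s (hs : is_section n s) : twist_sections S n :=
  exist (fun s => s \in section_pred n) s (introT (section_predP n s) hs).

Lemma twist_sectionP n (s : twist_sections S n) : is_section n (\val s).
Proof. exact/section_predP/valP. Qed.

(** Both carriers are the same subtype, so the identity is the isomorphism. *)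
Lemma module_iso_twist0 :
  module_iso (R := structure_sections S) (twist_sections S 0) (structure_sections S)^o.
Proof.
pose f (s : twist_sections S 0) : (structure_sections S)^o := s.
have [|g hg] := @linear_of (structure_sections S) (twist_sections S 0)
  (structure_sections S)^o f.
  by move=> c u v; apply: val_inj.
by exists g; exists f => s; rewrite hg.
Qed.

(** As [h] vanishes nowhere, 1/h is a global section of O(-n), and multiplications by [h] and by 1/h
    are inverse to each other. *)
Lemma module_iso_homog_section n (h : S) : homog n h -> (forall p, ~ in_point p h) ->
  module_iso (R := structure_sections S) (twist_sections S n) (structure_sections S)^o.
Proof.
move=> hh ph; have hp p : homog_away_mulset p h by split; [exists n|apply: ph].
pose h' : local_sections S := fun p => frac 1 (hp p).
have hh' : is_cosection n h'.
  move=> p; exists setT; first by split=> //; apply: openT.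
  exists 0%N, 1, h; split=> // [|q _]; first exact: homog1.
  by exists (hp q).
have h'K : h' * homog_section h = 1.
  apply: functional_extensionality_dep => p.
  transitivity (h' p * homog_section h p) => //.
  by rewrite /h' fracM -[RHS]frac1; apply: frac_eqI; rewrite !mulr1.
have sec0 (s : twist_sections S n) : is_section 0 (h' * \val s).
  by apply: (is_section_cosectionM hh'); rewrite addn0; apply: twist_sectionP.
pose f (s : twist_sections S n) : (structure_sections S)^o := mk_section (sec0 s).
have secn (s : structure_sections S) : is_section n (homog_section h * \val s).
  rewrite -[n]addn0; apply: is_sectionM; first exact: homog_sectionP.
  exact/section_predP/(valP s).
pose g (s : structure_sections S) : twist_sections S n := mk_section (secn s).
have [|F hF] := @linear_of (structure_sections S) (twist_sections S n)
  (structure_sections S)^o f.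
  by move=> c u v; apply: val_inj; rewrite /= mulrDr mulrCA.
exists F; exists g => s; rewrite hF; apply: val_inj => /=.
  by rewrite mulrA [homog_section h * _]mulrC h'K mul1r.
by rewrite mulrA h'K mul1r.
Qed.

(** Multiplication by [y i] sends O(m) to O and O(m+n) to O(n). The first gives the coordinate forms
    of a dual basis with vectors [x i], the second the contractions, so the module is handled as a
    finite projective one. *)
Lemma twist_sections_tensor m n k (x : 'I_k -> twist_sections S m)
    (y : 'I_k -> local_sections S) :
  (forall i, is_cosection m (y i)) -> \sum_i \val (x i) * y i = 1 ->
  is_tensor_product (R := structure_sections S) (twist_sections S m)
    (twist_sections S n) (twist_sections S (m + n)).
Proof.
move=> hy xy.
have sec_t (u : twist_sections S m) (v : twist_sections S n) :
    is_section (m + n) (\val u * \val v).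
  by apply: is_sectionM; apply: twist_sectionP.
have sec_h i (u : twist_sections S (m + n)) : is_section n (y i * \val u).
  exact/(is_section_cosectionM (hy i))/twist_sectionP.
have sec_c i (u : twist_sections S m) : is_section 0 (y i * \val u).
  by apply: (is_section_cosectionM (hy i)); rewrite addn0; apply: twist_sectionP.
pose c i u : structure_sections S := mk_section (sec_c i u).
have val_sum n' r (F : 'I_r -> twist_sections S n') :
    \val (\sum_i F i) = \sum_i \val (F i).
  exact: (big_morph (fun u : twist_sections S n' => \val u)).
apply: (@tensor_product_dual_basis (structure_sections S) _ _ _
  (fun u v => mk_section (sec_t u v)) k x c (fun i u => mk_section (sec_h i u))).
- split=> [u|v] d u1 u2; apply: val_inj; rewrite /= ?mulrDr ?mulrDl.
    by rewrite mulrCA.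
  by rewrite mulrA.
- by move=> i d u v; apply: val_inj; rewrite /= mulrDr mulrCA.
- move=> u; apply: val_inj; rewrite val_sum -[RHS]mul1r -xy mulr_suml.
  by apply: eq_bigr => i _; rewrite /= -!mulrA [\val u * _]mulrC mulrCA.
- by move=> i u v; apply: val_inj; rewrite /= mulrA.
- move=> u; apply: val_inj; rewrite val_sum -[RHS]mul1r -xy mulr_suml.
  by apply: eq_bigr => i _; rewrite /= mulrA.
Qed.

(** Sections are families of germs, so gluing means choosing at each point a germ equal to whichever
    of the two fractions is defined there; compatibility matters only where both are. *)
Lemma glue_cosection n d e (f f' g g' : S) :
  homog d f -> homog (d + n) g -> homog e f' -> homog (e + n) g' ->
  (forall p, ~ in_point p g \/ ~ in_point p g') ->
  (forall p, ~ in_point p g -> ~ in_point p g' ->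
     exists2 t, homog_away_mulset p t & t * (f * g' - f' * g) = 0) ->
  exists2 s, is_cosection n s & forall p,
    (forall gp : homog_away_mulset p g, s p = frac f gp) /\
    (forall gp : homog_away_mulset p g', s p = frac f' gp).
Proof.
move=> hf hg hf' hg' cover compat.
have local p : {v : homog_loc p |
    (forall gp : homog_away_mulset p g, v = frac f gp) /\
    (forall gp : homog_away_mulset p g', v = frac f' gp)}.
  apply: cid; have [pg|pg] := cover p.
    have gp : homog_away_mulset p g by split=> //; exists (d + n)%N.
    exists (frac f gp); split=> [gp'|gp']; first exact: frac_eqI.
    by apply/fracP/compat; [case: gp|case: gp'].
  have gp : homog_away_mulset p g' by split=> //; exists (e + n)%N.
  exists (frac f' gp); split=> [gp'|gp']; last exact: frac_eqI.
  apply/esym/fracP; apply: compat; [by case: gp'|by case: gp].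
exists (fun p => sval (local p)) => [p|p]; last exact: (svalP (local p)).
have [pg|pg] := cover p.
  exists [set q : Proj S | ~ in_point q g]%classic; first exact: open_nbhs_homog hg pg.
  exists d, f, g; split=> // q qg.
  have gq : homog_away_mulset q g by split=> //; exists (d + n)%N.
  by exists gq; case: (svalP (local q)).
exists [set q : Proj S | ~ in_point q g']%classic; first exact: open_nbhs_homog hg' pg.
exists e, f', g'; split=> // q qg.
have gq : homog_away_mulset q g' by split=> //; exists (e + n)%N.
by exists gq; case: (svalP (local q)).
Qed.

End Sections.

(** Tensor products are unique up to isomorphism, so the products given for each [k] determine all
    tensor powers by induction. *)
Lemma tensor_power_twist (S : gradedRingType) n
    (T : lmodType (structure_sections S)) :
  (forall k, is_tensor_product (R := structure_sections S) (twist_sections S 1)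
    (twist_sections S k) (twist_sections S k.+1)) ->
  is_tensor_power (R := structure_sections S) (twist_sections S 1) n T <->
  module_iso T (twist_sections S n).
Proof.
move=> tensor; elim: n T => [|n IHn] T /=.
  have iso0 := module_iso_twist0 S.
  split=> isoT; apply: module_iso_trans isoT _ => //; exact: module_iso_sym.
split=> [[T' [/IHn isoT' prodT]]|isoT].
  apply: (tensor_product_unique prodT).
  exact (tensor_product_iso isoT' (module_iso_refl _) (tensor n)).
exists (twist_sections S n); split; first exact/IHn/module_iso_refl.
exact (tensor_product_iso (module_iso_refl _) (module_iso_sym isoT) (tensor n)).
Qed.

(** * Restriction along a morphism Spec A -> Proj S *)

(* Such a morphism is given by a graded map psi from S to A[T], regarded as a      *)
(* subring of A[[T]]; the value of z, homogeneous of degree d, is psi z d.        *)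
Section Restriction.
Variables (A : comPzRingType) (S : gradedRingType) (psi : {rmorphism S -> series A}).
Hypothesis psi_homog : forall d e (z : S), homog d z -> e != d -> psi z e = 0.
Hypothesis psi_relevant : forall q, prime_ideal q ->
  exists d (z : S), [/\ (0 < d)%N, homog d z & ~ q (psi z d)].
Implicit Types (q : A -> Prop) (s : local_sections S).

Lemma psi_homogM d e (x y : S) : homog d x -> psi (x * y) (d + e)%N = psi x d * psi y e.
Proof.
move=> hx; rewrite rmorphM coefsM.
have hd : (d < (d + e).+1)%N by rewrite ltnS leq_addr.
rewrite (bigD1 (Ordinal hd)) //= addKn big1 ?addr0 // => i.
by rewrite -val_eqE /= => hi; rewrite (psi_homog hx hi) mul0r.
Qed.

(** Gauss's lemma: if [i] and [j] are the lowest degrees whose coefficients in [f] and [g] lie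
    outside [q], the coefficient of degree [i + j] of the product is [f i * g j] modulo [q]. *)
Lemma prime_series q (f g : series A) : prime_ideal q ->
  (forall d, q ((f * g) d)) -> (forall d, q (f d)) \/ (forall d, q (g d)).
Proof.
move=> hq fg; apply: contrapT => /not_orP[/existsNP f0 /existsNP g0].
have min (h : series A) : (exists d, ~ q (h d)) ->
    exists m, ~ q (h m) /\ forall k, (k < m)%N -> q (h k).
  move=> [d hd]; have ex : exists d, `[< ~ q (h d) >] by exists d; apply/asboolP.
  case: (ex_minnP ex) => m /asboolP hm least; exists m; split=> // k.
  by rewrite ltnNge; apply: contraNP => hk; apply/least/asboolP.
have [i [fi fmin]] := min f f0; have [j [gj gmin]] := min g g0.
suff : q (f i * g j) by case/(prime_idealM hq).
have hi : (i < (i + j).+1)%N by rewrite ltnS leq_addr.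
have := fg (i + j)%N; rewrite coefsM (bigD1 (Ordinal hi)) //= addKn.
set x := f i * g j; set y := \sum_(k < _ | _) _ => qxy.
have qy : q (- 1 * y).
  apply: (idealM hq); rewrite /y; elim/big_rec: _ => [|k z ki qz].
    exact: (ideal0 hq).
  apply: (idealD hq) => //; move: ki; rewrite -val_eqE /= neq_ltn => /orP[ki|ki].
    by rewrite mulrC; apply: (idealM hq); apply: fmin.
  by apply: (idealM hq); apply: gmin; rewrite ltn_subLR ?ltn_add2r // -ltnS.
by have := idealD hq qxy qy; rewrite mulN1r addrK.
Qed.

(** This is the preimage of the prime q[[T]]. It is homogeneous because the coefficient of degree d
    of [psi z] depends only on the component of degree d of [z]. *)
Lemma spec_proj_point q : prime_ideal q -> proj_point (fun z : S => forall d, q (psi z d)).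
Proof.
move=> hq; split.
- by move=> d; rewrite rmorph0; apply: (ideal0 hq).
- by move=> x y qx qy d; rewrite rmorphD; apply: (idealD hq).
- move=> x y qy d; rewrite rmorphM coefsM.
  elim/big_rec: _ => [|k z _ qz]; first exact: (ideal0 hq).
  by apply: (idealD hq) => //; apply: (idealM hq).
- by move=> /(_ 0%N); rewrite rmorph1; apply: (prime_ideal1 hq).
- by move=> x y qxy; apply: prime_series => // d; rewrite -rmorphM.
- move=> z qz; have [n [c [hc ez]]] := homog_decomp z.
  (* The components from [n] on do not enter the sum for [z], hence need not lie in the point, and
     are replaced by 0. *)
  exists n, (fun d => if (d < n)%N then c d else 0).
  split=> [d|]; last by rewrite ez; apply: eq_bigr => i _; rewrite ltn_ord.
  case: ifP => [dn|_]; last first.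
    by split=> [|e]; [exact: homog0|rewrite rmorph0; apply: (ideal0 hq)].
  split=> // e; have [->|ed] := eqVneq e d; last first.
    by rewrite (psi_homog (hc d) ed); apply: (ideal0 hq).
  have := qz d; rewrite ez rmorph_sum coefs_sum (bigD1 (Ordinal dn)) //=.
  rewrite big1 ?addr0 // => i; rewrite -val_eqE eq_sym => id.
  exact: psi_homog id.
- have [d [z [d0 hz qz]]] := psi_relevant hq.
  by move=> /(_ d z d0 hz d).
Qed.

Definition spec_point q (hq : prime_ideal q) : Proj S := exist _ _ (spec_proj_point hq).

Lemma in_spec_point q (hq : prime_ideal q) d z :
  homog d z -> in_point (spec_point hq) z <-> q (psi z d).
Proof.
move=> hz; split=> [/(_ d)//|qz e].
by have [->//|/(psi_homog hz) ->] := eqVneq e d; apply: (ideal0 hq).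
Qed.

(* The germ of s at the point under q restricts to f / g in the stalk at q. *)
Definition restricts_to n s q (hq : prime_ideal q) (f g : A) : Prop :=
  exists d (x y : S) (hy : homog_away_mulset (spec_point hq) y),
    [/\ homog (d + n) x, homog d y, s (spec_point hq) = frac x hy &
      exists2 t, ~ q t & t * (psi x (d + n)%N * g - f * psi y d) = 0].

(** Both fractions are images of the same germ: applying [psi], in the right degree, to an equality
    of homogeneous fractions gives an equality in the local ring at [q]. *)
Lemma restricts_to_unique n s q (hq : prime_ideal q) f g f' g' :
  restricts_to n s hq f g -> restricts_to n s hq f' g' ->
  exists2 t, ~ q t & t * (f * g' - f' * g) = 0.
Proof.
move=> [d [x [y [hy [dx dy sq [t qt et]]]]]].
move=> [d' [x' [y' [hy' [dx' dy' sq' [t' qt' et']]]]]].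
have /fracP[u [[e du] qu] eu] := etrans (esym sq) sq'.
have qy : ~ q (psi y d) by case: (hy) => _; apply: contra_not => /in_spec_point; apply.
have qy' : ~ q (psi y' d').
  by case: (hy') => _; apply: contra_not => /in_spec_point; apply.
have {}qu : ~ q (psi u e) by apply: contra_not qu => /in_spec_point; apply.
have {}eu : psi u e * (psi x (d + n)%N * psi y' d' - psi x' (d' + n)%N * psi y d) = 0.
  rewrite -(psi_homogM _ _ dx) -(psi_homogM _ _ dx').
  have -> : (d' + n + d = d + n + d')%N by lia.
  rewrite (_ : _ - _ = psi (x * y' - x' * y) (d + n + d')%N); last by rewrite rmorphB.
  by rewrite -psi_homogM // eu rmorph0.
exists (t * t' * psi u e * psi y d * psi y' d').
  by do 4![case/(prime_idealM hq)=> //].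
move: (psi x _) (psi y _) (psi x' _) (psi y' _) (psi u _) et et' eu => X Y X' Y' U.
move=> et et' eu; transitivity (- (t' * U * Y' * g') * (t * (X * g - f * Y))
  + t * U * Y * g * (t' * (X' * g' - f' * Y'))
  + t * t' * g * g' * (U * (X * Y' - X' * Y))); first by ring.
by rewrite et et' eu !mulr0 !addr0.
Qed.

(** The power T^n trivialises the pullback of O(n) to Spec A, so the pulled-back section is a
    function there, that is, one element of [A]. *)
Lemma restriction n s : is_section n s ->
  exists z, forall q (hq : prime_ideal q), restricts_to n s hq z 1.
Proof.
move=> hs; pose E f g := forall q (hq : prime_ideal q), ~ q g -> restricts_to n s hq f g.
have [|||z hz] := @affine_gluing A E.
- move=> c f g Efg q hq qcg.
  have [|d [x [y [hy [dx dy sq [t qt et]]]]]] := Efg q hq.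
    by apply: contra_not qcg; apply: (idealM hq).
  exists d, x, y, hy; split=> //; exists t => //.
  by rewrite mulrCA -mulrA -mulrBr mulrCA et mulr0.
- move=> q hq; have [U [Uo Up] [d [x [y [dx dy sU]]]]] := hs (spec_point hq).
  have [y0 _] := sU _ Up.
  have {y0} qy : ~ q (psi y d).
    by case: y0 => _; apply: contra_not => /in_spec_point; apply.
  have [F [Fhomog UF]] := Uo.
  have /existsNP[h /not_implyP[Fh qh]] := (UF _).1 Up.
  have [e dh] := Fhomog h Fh.
  (* The extra factor [psi h e] shrinks the basic open set into the preimage of [U], where [s] is
     known to be [x / y]. *)
  exists (psi h e * psi x (d + n)%N), (psi h e * psi y d); split; last first.
    by case/(prime_idealM hq) => // /(in_spec_point hq dh).
  move=> p hp phy; have [|y0 sp] := sU (spec_point hp).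
    apply/UF => /(_ h Fh) /(_ e) ph; apply: phy; rewrite mulrC.
    exact: (idealM hp).
  exists d, x, y, y0; split=> //; exists 1; first exact: (prime_ideal1 hp).
  by rewrite mul1r mulrCA mulrA subrr.
- move=> f g f' g' q Efg Ef'g' hq qg qg'.
  exact: restricts_to_unique (Efg q hq qg) (Ef'g' q hq qg').
exists z => q hq; have [f [g [Efg qg [t qt et]]]] := hz q hq.
have [d [x [y [hy [dx dy sq [u qu eu]]]]]] := Efg q hq qg.
exists d, x, y, hy; split=> //; exists (t * u * g).
  by do 2![case/(prime_idealM hq)=> //].
rewrite mulr1; transitivity (t * (u * (psi x (d + n)%N * g - f * psi y d))
  + u * psi y d * (t * (f - z * g))); first by ring.
by rewrite et eu !mulr0 addr0.
Qed.

(** If [z] lay in a prime [q], the numerator of the germ of [s] at the point under [q] would lie in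
    that point, and the germ could not be invertible. *)
Lemma restriction_unit n s z : (forall p, is_unit (s p)) ->
  (forall q (hq : prime_ideal q), restricts_to n s hq z 1) -> is_unit z.
Proof.
move=> sunit hz; apply: is_unit_local => q hq qz.
have [d [x [y [hy [dx dy sq [t qt et]]]]]] := hz q hq.
have [v] := sunit (spec_point hq); have [b [c [hc <-]]] := frac_surj v.
rewrite sq fracM -frac1 => /fracP[u [_ qu]]; rewrite mulr1 mul1r mulrBr.
move=> /eqP; rewrite subr_eq0 => /eqP eu.
have xP : in_point (spec_point hq) x.
  apply/(in_spec_point hq dx).
  have : q (t * psi x (d + n)%N).
    move: et; rewrite mulr1 mulrBr => /eqP; rewrite subr_eq0 => /eqP ->.
    by rewrite mulrCA mulrC; apply: (idealM hq).
  by case/(prime_idealM hq).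
have hp := pointP (spec_point hq).
have : in_point (spec_point hq) (u * (y * c)).
  by rewrite -eu mulrCA mulrC; apply: (proj_idealM hp).
by case/(proj_primeM hp) => [/qu//|/(proj_primeM hp)[|]]; [case: (hy)|case: (hc)].
Qed.

End Restriction.

(** * Homogeneous evaluation *)

Lemma quot_lift (R R' : comPzRingType) (f : R) (phi : {rmorphism R -> R'}) :
  phi f = 0 ->
  {psi : {rmorphism principal_quot f -> R'} | forall x, psi (quot_pi f x) = phi x}.
Proof.
move=> phif; pose psi (z : principal_quot f) := phi (repr (z : Quotient.quot (principal f))).
have psiE x : psi (quot_pi f x) = phi x.
  have : quot_pi f (repr (quot_pi f x : Quotient.quot (principal f))) = quot_pi f x.
    exact: reprK.
  move=> /quot_piP/principalP[q e]; apply/eqP; rewrite -subr_eq0 -rmorphB e.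
  by rewrite rmorphM phif mulr0.
have psiB : zmod_morphism psi.
  move=> z w; have [x <-] := quot_pi_surj z; have [y <-] := quot_pi_surj w.
  by rewrite -quot_piB !psiE rmorphB.
have psiM : monoid_morphism psi.
  split=> [|z w]; first by rewrite -(rmorph1 (quot_pi f)) psiE rmorph1.
  have [x <-] := quot_pi_surj z; have [y <-] := quot_pi_surj w.
  by rewrite -rmorphM !psiE rmorphM.
pose Bm := GRing.isZmodMorphism.Build _ _ psi psiB.
pose Mm := GRing.isMonoidMorphism.Build _ _ psi psiM.
by exists (HB.pack_for {rmorphism principal_quot f -> R'} psi Bm Mm).
Qed.

Section Monomials.
Variable A : comPzRingType.
Implicit Types (P Q : bipoly A) (c : A).

Definition smonom (d : nat) c : series A := fun e => if e == d then c else 0.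

Lemma smonomM d e (x y : A) : smonom d x * smonom e y = smonom (d + e) (x * y).
Proof.
apply: functional_extensionality_dep => n; rewrite coefsM /smonom.
have [dn|nd] := leqP d n.
  rewrite (bigD1 (Ordinal (dn : d < n.+1)%N)) //= eqxx big1 ?addr0.
    have -> : (n - d == e)%N = (n == d + e)%N by lia.
    by case: ifP; rewrite ?mulr0.
  by move=> i; rewrite -val_eqE /= => /negPf ->; rewrite mul0r.
rewrite big1; first by case: eqP => // en; move: nd; rewrite en; lia.
move=> i _; case: eqP => [id|]; last by rewrite mul0r.
by have := ltn_ord i; lia.
Qed.

Definition monom (i j : nat) c : bipoly A :=
  mk_bipoly (i + j).+1 (fun k l => if (k == i) && (l == j) then c else 0).

Lemma coef2_monom i j c k l :
  coef2 (monom i j c) k l = if (k == i) && (l == j) then c else 0.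
Proof.
by rewrite coef2_mk; case: andP => [[/eqP-> /eqP->]|_]; rewrite ?ltnS ?leqnn ?if_same.
Qed.

Lemma monom_homog i j c : homog (i + j) (monom i j c).
Proof.
move=> k l kl; rewrite coef2_monom; case: andP => // -[/eqP ki /eqP lj].
by rewrite ki lj eqxx in kl.
Qed.

Lemma monomM i j i' j' (x y : A) :
  monom i j x * monom i' j' y = monom (i + i') (j + j') (x * y).
Proof.
apply: bipolyP => k l; rewrite coef2M coef2_monom.
have [ik|ki] := leqP i k; last first.
  rewrite ifF; last by apply/negbTE; lia.
  rewrite big1 // => m _; rewrite big1 // => n _; rewrite coef2_monom.
  by rewrite ifF ?mul0r //; apply/negbTE; have := ltn_ord m; lia.
have [jl|lj] := leqP j l; last first.
  rewrite ifF; last by apply/negbTE; lia.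
  rewrite big1 // => m _; rewrite big1 // => n _; rewrite coef2_monom.
  by rewrite ifF ?mul0r //; apply/negbTE; have := ltn_ord n; lia.
rewrite (bigD1 (Ordinal (ik : i < k.+1)%N)) //= (bigD1 (Ordinal (jl : j < l.+1)%N)) //=.
rewrite [X in _ + X]big1 ?addr0 => [|m]; last first.
  rewrite -val_eqE /= => mi; rewrite big1 // => n _.
  by rewrite coef2_monom (negPf mi) mul0r.
rewrite big1 ?addr0 => [|n]; last first.
  by rewrite -val_eqE /= => nj; rewrite coef2_monom (negPf nj) andbF mul0r.
rewrite !coef2_monom !eqxx /=.
have -> : (k - i == i')%N && (l - j == j')%N = (k == i + i')%N && (l == j + j')%N by lia.
by case: ifP; rewrite ?mulr0.
Qed.

Lemma monom_expand P : exists N, P = \sum_(i < N) \sum_(j < N) monom i j (coef2 P i j).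
Proof.
have [N hN] := coef2_finite P; exists N; apply: bipolyP => k l; rewrite coef2_sum.
under eq_bigr do rewrite coef2_sum.
have [kN|Nk] := ltnP k N; last first.
  rewrite hN ?(leq_trans Nk) ?leq_addr // big1 // => i _; rewrite big1 // => j _.
  by rewrite coef2_monom ifF //; apply/negbTE; have := ltn_ord i; lia.
have [lN|Nl] := ltnP l N; last first.
  rewrite hN ?(leq_trans Nl) ?leq_addl // big1 // => i _; rewrite big1 // => j _.
  by rewrite coef2_monom ifF //; apply/negbTE; have := ltn_ord j; lia.
rewrite (bigD1 (Ordinal kN)) //= (bigD1 (Ordinal lN)) //=.
rewrite [X in _ + X]big1 ?addr0 => [|i]; last first.
  rewrite -val_eqE /= eq_sym => ki; rewrite big1 // => j _.
  by rewrite coef2_monom (negPf ki).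
rewrite big1 ?addr0 => [|j]; last first.
  by rewrite -val_eqE /= eq_sym => lj; rewrite coef2_monom (negPf lj) andbF.
by rewrite coef2_monom !eqxx.
Qed.

Lemma monom_expand_homog d P : homog d P ->
  P = \sum_(i < d.+1) monom i (d - i) (coef2 P i (d - i)).
Proof.
move=> hP; apply: bipolyP => k l; rewrite coef2_sum.
have [<-|kld] := eqVneq (k + l)%N d; last first.
  rewrite hP // big1 // => i _; rewrite coef2_monom ifF //; apply/negbTE.
  by move: kld; have := ltn_ord i; lia.
have kd : (k < (k + l).+1)%N by lia.
rewrite (bigD1 (Ordinal kd)) //= coef2_monom addKn !eqxx big1 ?addr0 // => i.
by rewrite -val_eqE /= eq_sym => ne; rewrite coef2_monom (negPf ne).
Qed.

Lemma bipolyC_monom c : bipolyC c = monom 0 0 c.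
Proof. by apply: bipolyP => -[|k] [|l]; rewrite [RHS]coef2_monom. Qed.

Fact bipolyC_zmod_morphism : zmod_morphism (@bipolyC A).
Proof.
move=> c d; rewrite !bipolyC_monom; apply: bipolyP => k l; rewrite coef2B !coef2_monom.
by case: ifP; rewrite ?subr0.
Qed.
HB.instance Definition _ :=
  GRing.isZmodMorphism.Build A (bipoly A) (@bipolyC A) bipolyC_zmod_morphism.

Fact bipolyC_monoid_morphism : monoid_morphism (@bipolyC A).
Proof.
split=> [|c d]; first by apply: bipolyP => -[|k] [|l].
by rewrite !bipolyC_monom monomM.
Qed.
HB.instance Definition _ :=
  GRing.isMonoidMorphism.Build A (bipoly A) (@bipolyC A) bipolyC_monoid_morphism.

Lemma bipolyX_monom : bipolyX A = monom 1 0 1.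
Proof. by apply: bipolyP => -[|[|k]] [|[|l]]; rewrite [RHS]coef2_monom coef2_mk. Qed.

Lemma bipolyY_monom : bipolyY A = monom 0 1 1.
Proof. by apply: bipolyP => -[|[|k]] [|[|l]]; rewrite [RHS]coef2_monom coef2_mk. Qed.

Lemma bipolyX_homog : homog 1 (bipolyX A).
Proof. by rewrite bipolyX_monom; exact: (@monom_homog 1 0). Qed.

Lemma bipolyY_homog : homog 1 (bipolyY A).
Proof. by rewrite bipolyY_monom; exact: (@monom_homog 0 1). Qed.

Lemma bipolyC_homog c : homog 0 (bipolyC c).
Proof. by rewrite bipolyC_monom; exact: (@monom_homog 0 0). Qed.

Lemma monomE i j c : monom i j c = bipolyC c * bipolyX A ^+ i * bipolyY A ^+ j.
Proof.
have XnE n : bipolyX A ^+ n = monom n 0 1.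
  elim: n => [|n IHn]; first by rewrite -bipolyC_monom rmorph1.
  by rewrite exprS IHn bipolyX_monom monomM mulr1.
have YnE n : bipolyY A ^+ n = monom 0 n 1.
  elim: n => [|n IHn]; first by rewrite -bipolyC_monom rmorph1.
  by rewrite exprS IHn bipolyY_monom monomM mulr1.
by rewrite XnE YnE bipolyC_monom !monomM !mulr1 add0n addn0.
Qed.

End Monomials.

Section HomogeneousEvaluation.
Variables (A : comPzRingType) (u v : A).
Implicit Types (P Q : bipoly A).

(* The image of P in A[[T]] under X |-> uT, Y |-> vT. *)
Definition heval P : series A :=
  fun d => \sum_(i < d.+1) coef2 P i (d - i) * u ^+ i * v ^+ (d - i).

Fact heval_zmod_morphism : zmod_morphism heval.
Proof.
move=> P Q; apply: functional_extensionality_dep => d.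
transitivity (heval P d - heval Q d) => //; rewrite /heval -sumrB.
by apply: eq_bigr => i _; rewrite coef2B !mulrBl.
Qed.
HB.instance Definition _ :=
  GRing.isZmodMorphism.Build (bipoly A) (series A) heval heval_zmod_morphism.

Lemma heval_monom i j c : heval (monom i j c) = smonom (i + j) (c * u ^+ i * v ^+ j).
Proof.
apply: functional_extensionality_dep => d; rewrite /heval /smonom.
under eq_bigr do rewrite coef2_monom.
have [->|dij] := eqVneq d (i + j)%N.
  have ii : (i < (i + j).+1)%N by lia.
  rewrite (bigD1 (Ordinal ii)) //= addKn !eqxx big1 ?addr0 // => k.
  by rewrite -val_eqE /= => /negPf ->; rewrite !mul0r.
rewrite big1 // => k _; rewrite ifF ?mul0r //; apply/negbTE.
by move: dij; have := ltn_ord k; lia.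
Qed.

Fact heval_monoid_morphism : monoid_morphism heval.
Proof.
split=> [|P Q].
  have -> : (1 : bipoly A) = bipolyC 1 by rewrite rmorph1.
  by rewrite bipolyC_monom heval_monom !mulr1; apply: functional_extensionality_dep => -[|d].
(* Both sides are biadditive, so it suffices to multiply monomials. *)
have [M ->] := monom_expand P; have [N ->] := monom_expand Q.
rewrite !raddf_sum !mulr_suml raddf_sum; apply: eq_bigr => i _.
rewrite !raddf_sum !mulr_suml raddf_sum; apply: eq_bigr => j _.
rewrite !mulr_sumr raddf_sum; apply: eq_bigr => i' _.
rewrite !raddf_sum !mulr_sumr raddf_sum; apply: eq_bigr => j' _.
rewrite /= monomM !heval_monom smonomM addnACA; congr smonom.
by rewrite !exprD; ring.
Qed.
HB.instance Definition _ :=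
  GRing.isMonoidMorphism.Build (bipoly A) (series A) heval heval_monoid_morphism.

Lemma heval_homog d e P : homog d P -> e != d -> heval P e = 0.
Proof.
move=> hP ed; rewrite /heval big1 // => i _; rewrite hP ?mul0r //.
by move: ed; have := ltn_ord i; lia.
Qed.

Lemma eval2_heval d P : homog d P -> eval2 P u v = heval P d.
Proof.
move=> hP; rewrite /heval /eval2.
pose f m := coef2 P m.1 m.2 * u ^+ m.1 * v ^+ m.2.
pose r := [seq (i, d - i)%N | i <- iota 0 d.+1].
rewrite (fsbigE r f) //.
- rewrite (eq_bigl xpredT) => [|m]; last by rewrite in_setT.
  by rewrite big_map -/(index_iota 0 d.+1) big_mkord.
- by rewrite map_inj_uniq ?iota_uniq // => i j [].
- move=> [i j] _ ijr; rewrite /f hP ?mul0r //=; apply: contraNneq ijr => ijd.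
  apply/mapP; exists i; first by rewrite mem_iota; lia.
  by congr pair; lia.
Qed.

Lemma heval_add d P Q : heval (P + Q) d = heval P d + heval Q d.
Proof. by rewrite raddfD. Qed.

Lemma heval_sub d P Q : heval (P - Q) d = heval P d - heval Q d.
Proof. by rewrite raddfB. Qed.

Lemma heval_mul d e P Q : homog d P ->
  heval (P * Q) (d + e) = heval P d * heval Q e.
Proof. by apply: psi_homogM => d' e' R; apply: heval_homog. Qed.

Lemma hevalX : heval (bipolyX A) 1 = u.
Proof. by rewrite bipolyX_monom heval_monom mul1r mulr1. Qed.

Lemma hevalY : heval (bipolyY A) 1 = v.
Proof. by rewrite bipolyY_monom heval_monom !mul1r. Qed.

Lemma hevalC c : heval (bipolyC c) 0 = c.
Proof. by rewrite bipolyC_monom heval_monom !mulr1. Qed.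

(** Since [X] is [u W] and [Y] is [v W] modulo [I], each monomial of degree d becomes its value at
    (u,v) times [W ^+ d]. Here [W] plays the coordinate along the copy of Spec A with coordinates
    (u,v). *)
Lemma homog_congr (I : bipoly A -> Prop) d P W : ideal I ->
  I (bipolyX A - bipolyC u * W) -> I (bipolyY A - bipolyC v * W) -> homog d P ->
  I (P - bipolyC (heval P d) * W ^+ d).
Proof.
move=> hI hX hY hP.
have powI n x y : I (x - y) -> I (x ^+ n - y ^+ n).
  by move=> xy; rewrite subrXX mulrC; apply: (idealM hI).
rewrite {1}(monom_expand_homog hP) /heval rmorph_sum mulr_suml -sumrB.
elim/big_rec: _ => [|i R _ IR]; first exact: (ideal0 hI).
apply: (idealD hI) IR; rewrite monomE !rmorphM !rmorphXn -!mulrA -mulrBr.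
apply: (idealM hI); have id : (i <= d)%N by rewrite -ltnS.
rewrite -[X in W ^+ X](subnKC id) exprD.
set X := bipolyX A; set Y := bipolyY A; set Z := bipolyC u; set T := bipolyC v.
have -> : X ^+ i * Y ^+ (d - i) - Z ^+ i * (T ^+ (d - i) * (W ^+ i * W ^+ (d - i)))
  = X ^+ i * (Y ^+ (d - i) - (T * W) ^+ (d - i))
    + (T * W) ^+ (d - i) * (X ^+ i - (Z * W) ^+ i).
  by rewrite !exprMn; ring.
by apply: (idealD hI); apply: (idealM hI); apply: powI.
Qed.

End HomogeneousEvaluation.

(** * The scheme S(a,b) *)

(* Along V(x) and V(ay - bx), the sections y1 and y2 of degree -1 restrict to    *)
(* (0, 1/y) and (a/w, v/w), where w = ux + vy; so u w y1 + y y2 = 1 on both.     *)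
Lemma twist_sections_tensor_of_relation (S : gradedRingType) (x y a b u v : S) k :
  homog 1 x -> homog 1 y -> homog 0 a -> homog 0 b -> homog 0 u -> homog 0 v ->
  x * (a * y - b * x) = 0 -> a * u + b * v = 1 ->
  (forall p : Proj S, ~ in_point p x \/ ~ in_point p y) ->
  is_tensor_product (R := structure_sections S) (twist_sections S 1)
    (twist_sections S k) (twist_sections S k.+1).
Proof.
move=> hX hY ha hb hu hv e2 e1 coverXY.
have {}e1 : 1 - (a * u + b * v) = 0 by rewrite e1 subrr.
have hYY : homog (1 + 1)%N (y * y) := homogM _ _ _ _ hY hY.
have cover p : ~ in_point p x \/ ~ in_point p (y * y).
  have [|py] := coverXY p; [by left|right].
  by move=> /(proj_primeM (pointP p))[].
have awayX p : ~ in_point p x -> homog_away_mulset p x by split=> //; exists 1%N.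
have awayY p : ~ in_point p (y * y) -> homog_away_mulset p (y * y).
  by split=> //; exists 2%N.
(* On D(x) one has ay = bx, hence x = aw and y = bw, so a/w and v/w become a^2/x and va/x. On D(y)
   the fractions b^2 x/y^2 and (y - bux)/y^2 restrict to a/w and v/w along ay = bx, and to 0 and 1/y
   along x = 0. *)
have [|||y1 hy1 y1E] :=
    @glue_cosection _ 1 0 1 (a * a) (b * b * x) x (y * y) _ hX _ hYY cover.
- exact: (@homogM _ 0 0).
- by apply: (@homogM _ 0 1) hX; apply: (@homogM _ 0 0).
- move=> p px _; exists x; first exact: awayX.
  transitivity ((a * y + b * x) * (x * (a * y - b * x))); first by ring.
  by rewrite e2 mulr0.
have [|||y2 hy2 y2E] :=
    @glue_cosection _ 1 0 1 (v * a) (y - b * u * x) x (y * y) _ hX _ hYY cover.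
- exact: (@homogM _ 0 0).
- by apply: (homogB _ _ _ hY); apply: (@homogM _ 0 1) hX; apply: (@homogM _ 0 0).
- move=> p px _; exists x; first exact: awayX.
  transitivity ((v * y - u * x) * (x * (a * y - b * x))
    - (1 - (a * u + b * v)) * x * x * y); first by ring.
  by rewrite e1 e2 mulr0 !mul0r subr0.
have hx1 : homog 1 (u * (u * x + v * y)).
  by apply: (@homogM _ 0 1 _ _ hu); apply: homogD; apply: (@homogM _ 0 1).
pose x_ (i : 'I_2) : twist_sections S 1 :=
  if i == 0 then mk_section (homog_sectionP hx1) else mk_section (homog_sectionP hY).
pose y_ (i : 'I_2) : local_sections S := if i == 0 then y1 else y2.
apply: (@twist_sections_tensor S 1 k 2 x_ y_) => [i|].
  by rewrite /y_; case: ifP.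
rewrite big_ord_recl big_ord1 /x_ /y_ /=.
have frac_sum1 p (f g f' g' h : S) (hp : homog_away_mulset p h) t :
    homog_away_mulset p t ->
    t * (f * g + f' * g' - h) = 0 ->
    homog_section f p * frac g hp + homog_section f' p * frac g' hp = 1.
  move=> ht e; rewrite !fracM fracD -frac1; apply/fracP; exists t => //.
  transitivity (h * (t * (f * g + f' * g' - h))); first by ring.
  by rewrite e mulr0.
apply: functional_extensionality_dep => p.
transitivity (homog_section (u * (u * x + v * y)) p * y1 p
  + homog_section y p * y2 p) => //.
(* On D(x) the identity of numerators is checked after multiplication by x, which brings in the
   relation; on D(y) it holds in [S] itself. *)
have [/awayX gp|/awayY gp] := cover p.
  rewrite ((y1E p).1 gp) ((y2E p).1 gp); apply: (frac_sum1 _ _ _ _ _ _ _ x gp).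
  transitivity ((u * v * a + v) * (x * (a * y - b * x))
    - (1 - (a * u + b * v)) * (1 + a * u) * x * x); first by ring.
  by rewrite e1 e2 mulr0 !mul0r subr0.
rewrite ((y1E p).2 gp) ((y2E p).2 gp); apply: (frac_sum1 _ _ _ _ _ _ _ _ (mulset1 _)).
transitivity (- (b * u * u) * (x * (a * y - b * x))
  - (1 - (a * u + b * v)) * b * u * x * y); first by ring.
by rewrite e1 e2 mulr0 !mul0r subr0.
Qed.

Section GoodPoints.
Variables (A : comPzRingType) (a b : A).
Local Notation S := (Axy a b).
Local Notation X := (bipolyX A).
Local Notation Y := (bipolyY A).
Local Notation C := (@bipolyC A).
Local Notation pi := (quot_pi (Axy_relation a b) : bipoly A -> S).
Implicit Types (P : bipoly A) (p : Proj S).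

Lemma pi_homog d P : homog d P -> homog d (pi P).
Proof. by exists P. Qed.

Lemma pi_relation : pi X * (pi (C a) * pi Y - pi (C b) * pi X) = 0.
Proof.
rewrite -!rmorphM -rmorphB -rmorphM -[RHS](rmorph0 (quot_pi (Axy_relation a b))).
by apply/quot_piP; rewrite subr0; apply/principalP; exists 1; rewrite mul1r.
Qed.

Lemma in_point_ideal p : ideal (fun P => in_point p (pi P)).
Proof.
have hp := pointP p; split.
- by rewrite rmorph0; apply: (proj_ideal0 hp).
- by move=> P Q pP pQ; rewrite rmorphD; apply: (proj_idealD hp).
- by move=> P Q pQ; rewrite rmorphM; apply: (proj_idealM hp).
Qed.

Lemma in_pointX p P n : in_point p (pi P ^+ n) -> in_point p (pi P).
Proof.
have hp := pointP p; elim: n => [|n IHn]; first by move/(proj_prime1 hp).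
by rewrite exprS => /(proj_primeM hp)[|/IHn].
Qed.

Lemma Axy_cover p : ~ in_point p (pi X) \/ ~ in_point p (pi Y).
Proof.
have hp := pointP p; apply/not_andP => -[pX pY]; apply: (proj_relevant hp).
move=> d z d0 [P hP ->].
(* With [W] = 0 the value term carries the factor [0 ^+ d], which vanishes because d > 0. *)
have := homog_congr (u := 0) (v := 0) (W := 0) (in_point_ideal p) _ _ hP.
by rewrite !mulr0 !subr0 expr0n -[(d == 0)%N]negbK -lt0n d0 mulr0 subr0; apply.
Qed.

(** If P were in the point, its unit value would force [W], and then both [X] and [Y], into the
    point, against [Axy_cover]. *)
Lemma unit_notin_point p d P W u v : homog d P -> is_unit (heval u v P d) ->
  in_point p (pi (X - C u * W)) -> in_point p (pi (Y - C v * W)) ->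
  ~ in_point p (pi P).
Proof.
move=> hP [c cP] pX pY pP; have hI := in_point_ideal p.
have : in_point p (pi (W ^+ d)).
  have -> : W ^+ d = C c * (P - (P - C (heval u v P d) * W ^+ d)).
    by rewrite opprB addrCA subrr addr0 mulrA -rmorphM [c * _]mulrC cP rmorph1 mul1r.
  apply: (idealM hI); apply: (idealD hI) => //; rewrite -mulN1r.
  by apply: (idealM hI); apply: homog_congr hI pX pY hP.
rewrite rmorphXn => /in_pointX pW; have := Axy_cover p.
have pW' Z c' : in_point p (pi (Z - C c' * W)) -> in_point p (pi Z).
  move=> pZ; rewrite -[Z](subrK (C c' * W)).
  by apply: (idealD hI) => //; apply: (idealM hI).
by case; apply; [apply: pW' pX|apply: pW' pY].
Qed.

Lemma heval_relation u v : u * (a * v - b * u) = 0 -> heval u v (Axy_relation a b) = 0.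
Proof.
move=> e; apply: functional_extensionality_dep => d.
have [->|d2] := eqVneq d 2%N; last exact: (heval_homog u v (Axy_relation_homog a b) d2).
have hX := bipolyX_homog A; have hC := @bipolyC_homog A.
rewrite (@heval_mul _ u v 1 1 _ _ hX) heval_sub.
by rewrite !(@heval_mul _ u v 0 1) // !hevalC hevalX hevalY.
Qed.

Lemma Axy_restriction u v : u * (a * v - b * u) = 0 ->
  {psi : {rmorphism S -> series A} | (forall P, psi (pi P) = heval u v P) /\
    forall d e (z : S), homog d z -> e != d -> psi z e = 0}.
Proof.
move=> /heval_relation/quot_lift[psi psiE]; exists psi; split=> // d e z.
by move=> [P hP ->] ed; apply: etrans (heval_homog u v hP ed); rewrite psiE.
Qed.

Lemma restriction_relevant u v (psi : {rmorphism S -> series A}) q :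
  (forall P, psi (pi P) = heval u v P) -> primitive_point u v -> prime_ideal q ->
  exists d (z : S), [/\ (0 < d)%N, homog d z & ~ q (psi z d)].
Proof.
move=> psiE /(_ 1)[c [d e]] hq.
have [qu|qu] := pselect (q u); last first.
  exists 1%N, (pi X); split=> //; first exact/pi_homog/bipolyX_homog.
  by rewrite psiE hevalX.
exists 1%N, (pi Y); split=> //; first exact/pi_homog/bipolyY_homog.
rewrite psiE hevalY => qv; apply: (prime_ideal1 hq); rewrite e.
by apply: (idealD hq); rewrite mulrC; apply: (idealM hq).
Qed.

(** Every monomial of degree d other than Y^d contains X: it vanishes at (0,1) and has a multiple of
    a as value at (a,b). *)
Lemma heval_congr d P : exists l, heval a b P d = b ^+ d * heval 0 1 P d + l * a.
Proof.
rewrite /heval !big_ord_recl /= !expr0 !mulr1 subn0 !expr1n mulr1.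
rewrite [X in _ * (_ + X)]big1 ?addr0 => [|i _]; last first.
  by rewrite expr0n /= mulr0 mul0r.
exists (\sum_(i < d) coef2 P i.+1 (d - i.+1) * a ^+ i * b ^+ (d - i.+1)).
rewrite [b ^+ d * _]mulrC mulr_suml; congr (_ + _); apply: eq_bigr => i _.
by rewrite /bump /= add1n exprS; ring.
Qed.

Hypothesis hab : primitive_point a b.

Lemma twist_sections_tensor_Axy k :
  is_tensor_product (R := structure_sections S) (twist_sections S 1)
    (twist_sections S k) (twist_sections S k.+1).
Proof.
have [u [v e1]] := hab 1.
have hC c : homog 0 (pi (C c)) by apply/pi_homog/bipolyC_homog.
apply: (@twist_sections_tensor_of_relation _ (pi X) (pi Y) (pi (C a)) (pi (C b))
  (pi (C u)) (pi (C v))) => //.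
- exact/pi_homog/bipolyX_homog.
- exact/pi_homog/bipolyY_homog.
- exact: pi_relation.
- by rewrite -!rmorphM -rmorphD -rmorphD -e1 !rmorph1.
- exact: Axy_cover.
Qed.

Lemma torsion_twist_of_poly d P : (0 < d)%N -> homog d P ->
  is_unit (heval 0 1 P d) -> is_unit (heval a b P d) ->
  torsion_in_Pic (R := structure_sections S) (twist_sections S 1).
Proof.
have [u [v e1]] := hab 1.
case: d => // d _ hP P01 Pab; have hT := twist_sections_tensor_Axy.
have nowhere0 p : ~ in_point p (pi P).
  have hp := pointP p; have hI := in_point_ideal p.
  have : in_point p (pi (Axy_relation a b)).
    rewrite (_ : pi _ = 0); first exact: (proj_ideal0 hp).
    rewrite -[RHS](rmorph0 (quot_pi (Axy_relation a b))); apply/quot_piP.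
    by rewrite subr0; apply/principalP; exists 1; rewrite mul1r.
  (* A prime contains one factor of the relation. On X = 0 the coordinates are (0,1) with respect to
     Y; on aY - bX = 0 they are (a,b) with respect to uX + vY, because au + bv = 1. *)
  rewrite rmorphM => /(proj_primeM hp)[pX|pL].
    apply: (unit_notin_point (W := Y) hP P01); first by rewrite rmorph0 mul0r subr0.
    by rewrite rmorph1 mul1r subrr; apply: (ideal0 hI).
  have C1 : 1 = C a * C u + C b * C v by rewrite -!rmorphM -rmorphD -e1 rmorph1.
  apply: (unit_notin_point (W := C u * X + C v * Y) hP Pab).
    have -> : X - C a * (C u * X + C v * Y) = - C v * (C a * Y - C b * X).
      by rewrite -[X in X - _]mul1r C1; ring.
    exact: (idealM hI).
  have -> : Y - C b * (C u * X + C v * Y) = C u * (C a * Y - C b * X).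
    by rewrite -[Y in Y - _]mul1r C1; ring.
  exact: (idealM hI).
have iso1 := module_iso_homog_section (pi_homog hP) nowhere0.
split.
  (* As O(d+1) is trivial, O(d) is the inverse of O(1). *)
  exists (twist_sections S d).
  exact (tensor_product_iso (module_iso_refl _) iso1 (hT d)).
by exists d.+1 => //; apply/(tensor_power_twist _ _ hT)/module_iso_sym.
Qed.

Lemma good_point_of_torsion :
  torsion_in_Pic (R := structure_sections S) (twist_sections S 1) -> good_point a b.
Proof.
move=> [_ [n n0 /(tensor_power_twist _ _ twist_sections_tensor_Axy)[f [g fK gK]]]].
pose s : local_sections S := \val (f 1).
have hs : is_section n s by apply: twist_sectionP.
(* Some power [z ^+ n], with [z] one of x and y, is invertible at [p]; being a global section of
   O(n), it is a multiple of the generator [s]. *)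
have unit_s p : is_unit (s p).
  have [z hz pz] : exists2 z : S, homog 1 z & ~ in_point p z.
    case: (Axy_cover p) => pz; [exists (pi X)|exists (pi Y)] => //.
      exact/pi_homog/bipolyX_homog.
    exact/pi_homog/bipolyY_homog.
  have hzn : homog n (z ^+ n).
    elim: (n) => [|m IHm]; first exact: homog1.
    by rewrite exprS; apply: (homogM 1 m).
  have pzn : homog_away_mulset p (z ^+ n).
    split; first by exists n.
    elim: (n) => [|m IHm]; first exact: (proj_prime1 (pointP p)).
    by rewrite exprS => /(proj_primeM (pointP p))[].
  pose t := mk_section (homog_sectionP hzn).
  have tE : t = g t *: f 1 by rewrite -linearZ /= /GRing.scale /= mulr1 gK.
  have tp : \val (g t) p * s p = frac (z ^+ n) (mulset1 (homog_away_mulset p)).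
    by have := congr1 (fun r : twist_sections S n => \val r p) tE.
  exists (\val (g t) p * frac 1 pzn); rewrite mulrA [s p * _]mulrC tp fracM -frac1.
  by apply: frac_eqI; rewrite !mulr1 !mul1r.
have prim01 : primitive_point (0 : A) 1.
  by move=> c; exists 0, c; rewrite mul0r mul1r add0r.
have [|psi0 [psi0E psi0_homog]] := @Axy_restriction 0 1; first by rewrite mul0r.
have [|psi1 [psi1E psi1_homog]] := @Axy_restriction a b; first by ring.
have rel0 q := restriction_relevant psi0E prim01 (q := q).
have rel1 q := restriction_relevant psi1E hab (q := q).
have [z hz] := restriction psi0_homog rel0 hs.
have [w hw] := restriction psi1_homog rel1 hs.
have [zi zK] := restriction_unit unit_s hz.
have [wi wK] := restriction_unit unit_s hw.
have congr_psi d x : exists l, psi1 x d = b ^+ d * psi0 x d + l * a.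
  have [P <-] := quot_pi_surj x; have [l e] := heval_congr d P; exists l.
  by rewrite psi1E psi0E.
(* From w = z b^n - l a, division by the unit z leaves the unit b^n - (l/z) a. *)
suff [l el] : exists l, 1 * (z * b ^+ n - w) = l * a.
  split=> //; exists n; split=> //; exists (- (zi * l)), (z * wi).
  rewrite -[RHS]wK (_ : w = z * b ^+ n - l * a); last by rewrite -el mul1r subKr.
  transitivity ((z * b ^+ n - z * zi * (l * a)) * wi); first by ring.
  by rewrite zK mul1r.
(* The multipliers that bring z b^n - w into aA form an ideal; outside V(a) the element a itself is
   one. *)
apply: (@ideal_eq1 A (fun t => exists l, t * (z * b ^+ n - w) = l * a)).
  split=> [|t t' [l el] [l' el']|t t' [l el]].
  - by exists 0; rewrite !mul0r.
  - by exists (l + l'); rewrite !mulrDl el el'.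
  - by exists (t * l); rewrite -!mulrA el.
move=> q hq; have [qa|qa] := pselect (q a); last first.
  by exists a => //; exists (z * b ^+ n - w); rewrite mulrC.
have qb : ~ q b.
  move=> qb; apply: (prime_ideal1 hq); have [u [v ->]] := hab 1.
  by apply: (idealD hq); rewrite mulrC; apply: (idealM hq).
(* Modulo a prime containing a, and hence not b, [psi1] is [psi0] rescaled in degree d by the
   invertible b^d. The two image points are therefore equal, and one germ of [s] computes both [z]
   and [w]. *)
have same_point : spec_point psi0_homog rel0 hq = spec_point psi1_homog rel1 hq.
  apply: eq_exist; apply: funext => x; apply/propext; split=> h d.
    have [l ->] := congr_psi d x.
    by apply: (idealD hq); apply: (idealM hq).
  have [l e] := congr_psi d x.
  have : q (b ^+ d * psi0 x d).
    rewrite -[X in q X](addrK (l * a)) -e -mulN1r.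
    apply: (idealD hq); first exact: h.
    by apply: (idealM hq); apply: (idealM hq).
  by case/(prime_idealM hq) => // /(prime_idealX hq).
have [d [x [y [hy [dx dy sq [t qt et]]]]]] := hz q hq.
have : restricts_to psi1_homog rel1 n s hq (psi1 x (d + n)%N) (psi1 y d).
  move: hy sq; rewrite same_point => hy sq.
  exists d, x, y, hy; split=> //; exists 1; first exact: (prime_ideal1 hq).
  by rewrite mul1r subrr.
move=> /(restricts_to_unique (hw q hq))[t' qt' et'].
have qy : ~ q (psi0 y d).
  by case: (hy) => _; apply: contra_not => /(in_spec_point psi0_homog rel0 hq dy).
have qbd : ~ q (b ^+ d) by move/(prime_idealX hq).
(* Up to [t] and [t'], z is [psi0 x / psi0 y] and w is [psi1 x / psi1 y]; clearing the denominator
   b^d [psi0 y] leaves only the error terms [l a] and [l' a]. *)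
exists (t * t' * psi0 y d * b ^+ d).
  by do 3![case/(prime_idealM hq)=> //].
have [l el] := congr_psi d y; have [l' el'] := congr_psi (d + n)%N x.
exists (t * t' * (w * l - l')); move: et et'; rewrite el el' exprD.
move: (psi0 x _) (psi0 y _) => X0 Y0 et et'.
transitivity (- (t' * b ^+ d * b ^+ n) * (t * (X0 * 1 - z * Y0))
  - t * (t' * (w * (b ^+ d * Y0 + l * a) - (b ^+ d * b ^+ n * X0 + l' * a) * 1))
  + t * t' * (w * l - l') * a); first by ring.
by rewrite et et' !mulr0 subr0 add0r.
Qed.

Lemma good_point_of_poly d P : (0 < d)%N -> is_unit (heval 0 1 P d) ->
  is_unit (heval a b P d) -> good_point a b.
Proof.
move=> d0 [c cP] [c' c'P]; split=> //; exists d; split=> //.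
have [l e] := heval_congr d P; exists (c * l), (heval 0 1 P d * c').
transitivity (b ^+ d * heval 0 1 P d * c' + heval 0 1 P d * c * (l * a * c')).
  by ring.
by rewrite cP mul1r -mulrDl -e.
Qed.

(** The linear form [w] has value 1 at (a,b), so multiplying X by a power of it raises the degree to
    that of Y^N without changing the value a; the factor X makes the added term vanish at (0,1). *)
Lemma poly_of_good_point : good_point a b ->
  exists (d : nat) (P : bipoly A),
    [/\ (1 <= d)%N, homog d P, is_unit (heval 0 1 P d) & is_unit (heval a b P d)].
Proof.
move=> [_ [[|n] [n0 [l hl]]]] //; have [u [v e1]] := hab 1.
pose w := C u * X + C v * Y.
have [hX hY] := (bipolyX_homog A, bipolyY_homog A); have hC := @bipolyC_homog A.
have hw : homog 1 w by apply: homogD; apply: (homogM 0 1).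
have powE u' v' P k : homog 1 P ->
    homog k (P ^+ k) /\ heval u' v' (P ^+ k) k = heval u' v' P 1 ^+ k.
  move=> hP; elim: k => [|k [hk ek]].
    by split; [exact: homog1|rewrite !expr0 rmorph1].
  rewrite !exprS; split; first exact: (homogM 1 k).
  by rewrite (@heval_mul _ _ _ 1 k) // ek.
have hwn := (powE 0 0 w n hw).1; have hYn := (powE 0 0 Y n.+1 hY).1.
have hXw : homog n.+1 (X * w ^+ n) by apply: (homogM 1 n).
have hQ : homog n.+1 (C l * (X * w ^+ n)) by apply: (homogM 0 n.+1).
have evalP u' v' : heval u' v' (Y ^+ n.+1 + C l * (X * w ^+ n)) n.+1
    = v' ^+ n.+1 + l * (u' * (u * u' + v * v') ^+ n).
  rewrite heval_add (powE _ _ _ _ hY).2 hevalY (@heval_mul _ _ _ 0 n.+1) // hevalC.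
  rewrite (@heval_mul _ _ _ 1 n) // hevalX (powE _ _ _ _ hw).2 heval_add.
  by rewrite !(@heval_mul _ _ _ 0 1) // !hevalC hevalX hevalY.
exists n.+1, (Y ^+ n.+1 + C l * (X * w ^+ n)); split=> //; first exact: homogD.
  by rewrite evalP mul0r mulr0 addr0 expr1n; exists 1; rewrite mulr1.
by rewrite evalP [u * a]mulrC [v * b]mulrC -e1 expr1n mulr1.
Qed.

End GoodPoints.

Theorem theorem3p1 (A : comPzRingType) (a b : A) (hab : primitive_point a b) :
  [<-> torsion_in_Pic (R := structure_sections (Axy a b)) (twist_sections (Axy a b) 1);
       exists (d : nat) (P : bipoly A),
         [/\ (1 <= d)%N, homog d P, is_unit (eval2 P 0 1) & is_unit (eval2 P a b)];
       good_point a b].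
Proof.
(* For homogeneous P the finitely supported sum [eval2] reduces to the antidiagonal of degree d,
   which is [heval]. *)
have evalE : (exists (d : nat) (P : bipoly A), [/\ (1 <= d)%N, homog d P,
      is_unit (eval2 P 0 1) & is_unit (eval2 P a b)]) <->
    (exists (d : nat) (P : bipoly A), [/\ (1 <= d)%N, homog d P,
      is_unit (heval 0 1 P d) & is_unit (heval a b P d)]).
  split=> -[d [P [d0 hP P01 Pab]]]; exists d, P; split=> //.
  - by rewrite -(eval2_heval _ _ hP).
  - by rewrite -(eval2_heval _ _ hP).
  - by rewrite (eval2_heval _ _ hP).
  - by rewrite (eval2_heval _ _ hP).
tfae.
- by move=> /(good_point_of_torsion hab)/(poly_of_good_point hab)/evalE.
- by move=> /evalE[d [P [d0 hP P01 Pab]]]; apply: (good_point_of_poly hab d0 P01 Pab).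
- move=> /(poly_of_good_point hab)[d [P [d0 hP P01 Pab]]].
  exact: (torsion_twist_of_poly hab d0 hP P01 Pab).
Qed.
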